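(* Let $\kappa=(k_n)_{n\in\mathbb N}$ and $\lambda=(l_n)_{n\in\mathbb N}$ be sequences of positive integers with $k_n\leq l_n$ for every $n\in\mathbb N$. Let $K_{k,l}$ denote the complete bipartite graph whose two parts have $k$ and $l$ vertices, and let $\Gamma_{\kappa,\lambda}=\bigsqcup_{n\in\mathbb N}K_{k_n,l_n}$ be the disjoint union. If the sequence $\frac{l_n}{k_n}$, $n\in\mathbb N$, is bounded, then $\Gamma_{\kappa,\lambda}$ is approximately uniformly locally finite (AULF); otherwise $\Gamma_{\kappa,\lambda}$ is not approximately uniformly locally finite.
   Context: All graphs are simple (no loops or multiple edges) and locally finite (every vertex has finitely many adjacent vertices), but not necessarily connected. For a graph $\Gamma$ with vertex set $V$, $d(v)$ is the degree of $v\in V$, $v\sim w$ means that $v$ and $w$ are adjacent, and $l^2(\Gamma)$ is the Hilbert space of square-summable complex functions on $V$, with orthonormal basis $\{\delta_v\}_{v\in V}$ of characteristic functions of vertices (the standard basis). The normalized Laplacian $L$ of $\Gamma$ is the bounded operator on $l^2(\Gamma)$ given by $Lf(v)=f(v)-\sum_{w\sim v}\frac{1}{\sqrt{d(v)d(w)}}f(w)$. For $d\in\mathbb N$, $\mathbb B^{(d)}$ is the set of bounded operators on $l^2(\Gamma)$ whose matrix with respect to the standard basis has at most $d$ non-zero entries in each row and in each column. Put $\mathbb B^{(\infty)}=\bigcup_{d\in\mathbb N}\mathbb B^{(d)}$ and let $\mathbb B$ be the closure of $\mathbb B^{(\infty)}$ in the operator norm. The graph $\Gamma$ is approximately uniformly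 locally finite (AULF) if $L\in\mathbb B$. *)

(* Defs.v *)
From HB Require Import structures.
From mathcomp Require Import all_boot all_order all_algebra finmap.
From mathcomp Require Import boolp classical_sets functions cardinality fsbigop.
From mathcomp Require Import reals ereal normedtype esum.
From mathcomp Require Import ring lra complex.

Set Implicit Arguments.
Unset Strict Implicit.
Unset Printing Implicit Defensive.

Import Order.TTheory GRing.Theory Num.Theory.
Import ComplexField.Normc.

Local Open Scope classical_set_scope.
Local Open Scope ring_scope.
Local Open Scope complex_scope.

(* Simple, locally finite, not necessarily connected graphs on the vertex type V. *)
Record lfgraph (V : choiceType) := LFGraph {
  adj :> rel V;
  adj_sym : symmetric adj;
  adj_irr : irreflexive adj;
  adj_lf : forall v, finite_set [set w | adj v w]
}.

Section Degree.
Variables (V : choiceType) (G : lfgraph V).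

Definition neighbors (v : V) : set V := [set w | G v w].

Definition degree (v : V) : nat := #|` fset_set (neighbors v)|%fset.

End Degree.

Section CompleteBipartite.
Variables k l : nat.

Definition is_left (A B : Type) (x : A + B) : bool :=
  if x is inl _ then true else false.

Definition bipartite_adj : rel ('I_k + 'I_l)%type :=
  fun x y => is_left x != is_left y.

Lemma bipartite_adj_sym : symmetric bipartite_adj.
Proof. by move=> x y; rewrite /bipartite_adj eq_sym. Qed.

Lemma bipartite_adj_irr : irreflexive bipartite_adj.
Proof. by move=> x; rewrite /bipartite_adj eqxx. Qed.

Lemma bipartite_adj_lf v : finite_set [set w | bipartite_adj v w].
Proof. exact: finite_finset. Qed.

Definition complete_bipartite : lfgraph ('I_k + 'I_l)%type :=
  LFGraph bipartite_adj_sym bipartite_adj_irr bipartite_adj_lf.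

End CompleteBipartite.

Section DisjointUnion.
Variables (I : choiceType) (V : I -> choiceType) (G : forall i, lfgraph (V i)).

(* tagged_as u v is tagged v transported to V (tag u), which is meaningful
   when tag u == tag v, as guarded here. *)
Definition union_adj : rel {i : I & V i} :=
  fun u v => (tag u == tag v) && G (tag u) (tagged u) (tagged_as u v).

Lemma union_adj_sym : symmetric union_adj.
Proof.
move=> [i x] [j y]; rewrite /union_adj /= eq_sym.
case: eqP => //= ij; case: _ / ij y => y in x *.
by rewrite !tagged_asE adj_sym.
Qed.

Lemma union_adj_irr : irreflexive union_adj.
Proof. by move=> [i x]; rewrite /union_adj eqxx tagged_asE adj_irr. Qed.

Lemma union_adj_lf u : finite_set [set w | union_adj u w].
Proof.
case: u => i x; apply: sub_finite_set
  (finite_image (fun y => Tagged V y) (adj_lf (G i) x)) => -[j y] /=.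
rewrite /union_adj /=; case: eqP => //= ij; case: _ / ij y => y.
by rewrite tagged_asE => xy; exists y.
Qed.

Definition disjoint_union : lfgraph {i : I & V i} :=
  LFGraph union_adj_sym union_adj_irr union_adj_lf.

End DisjointUnion.

Definition Gamma (k l : nat -> nat) :
    lfgraph {n : nat & ('I_(k n) + 'I_(l n))%type} :=
  disjoint_union (fun n => complete_bipartite (k n) (l n)).

Section L2.
Variables (R : realType) (V : choiceType).
Implicit Types f g : V -> R[i].

Definition l2sum f : \bar R := \esum_(v in [set: V]) (normc (f v) ^+ 2)%:E.

Definition square_summable : {pred V -> R[i]} := fun f => (l2sum f < +oo)%E.

Lemma normc_ge0 (x : R[i]) : 0 <= normc x.
Proof. by case: x => a b; rewrite sqrtr_ge0. Qed.

Lemma l2sum_ge0 f : (0 <= l2sum f)%E.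
Proof. by apply: esum_ge0 => v _; rewrite lee_fin sqr_ge0. Qed.

Lemma l2sum0 : l2sum 0 = 0%E.
Proof. by rewrite /l2sum esum1// => v _; rewrite normc0 expr0n. Qed.

Lemma le_esumZ (a : R) (u : V -> R) (w : V -> \bar R) : 0 <= a ->
  (forall v, 0 <= u v) ->
  (forall v, w v <= (a * u v)%:E)%E ->
  (\esum_(v in [set: V]) w v <= a%:E * \esum_(v in [set: V]) (u v)%:E)%E.
Proof.
move=> a0 u0 wu; apply: ge_ereal_sup => _ /= [X [finX _] <-].
apply: (@le_trans _ _ (\sum_(v \in X) (a * u v)%:E)%E).
  by apply: lee_fsum.
rewrite fsumEFin// -mulr_fsumr EFinM -fsumEFin//.
by rewrite lee_wpmul2l// ?lee_fin// ereal_sup_ubound//; exists X.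
Qed.

Lemma l2sumZ a f : (l2sum (a *: f) <= (normc a ^+ 2)%:E * l2sum f)%E.
Proof.
apply: le_esumZ => [|v|v]; rewrite ?sqr_ge0//.
by rewrite lee_fin -exprMn -normcM.
Qed.

Lemma l2sumD f g : (l2sum (f + g)%R <= 2%:E * (l2sum f + l2sum g))%E.
Proof.
rewrite /l2sum -esumD; try by move=> v _; rewrite lee_fin sqr_ge0.
under [X in (_ <= _ * X)%E]eq_esum do rewrite -EFinD.
apply: le_esumZ => // v; first by rewrite addr_ge0// sqr_ge0.
rewrite lee_fin.
have h := le_normcD (f v) (g v).
have h0 := normc_ge0 (f v + g v).
have := sqr_ge0 (normc (f v) - normc (g v)).
have hf := normc_ge0 (f v); have hg := normc_ge0 (g v).
rewrite -[(f + g) v]/(f v + g v); nra.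
Qed.

Lemma square_summable_closed : submod_closed square_summable.
Proof.
split=> [|a f g]; rewrite !unfold_in /square_summable ?l2sum0 ?ltry// => fo go.
apply: le_lt_trans (l2sumD _ _) _; rewrite lte_mul_pinfty// lte_add_pinfty//.
by apply: le_lt_trans (l2sumZ _ _) _; rewrite lte_mul_pinfty// lee_fin sqr_ge0.
Qed.

HB.instance Definition _ := GRing.isSubmodClosed.Build R[i] (V -> R[i])
  square_summable square_summable_closed.

Definition l2 : Type := {f : V -> R[i] | square_summable f}.
HB.instance Definition _ := SubChoice.on l2.
HB.instance Definition _ := [SubChoice_isSubLmodule of l2 by <:].

Definition l2norm (f : l2) : R := Num.sqrt (fine (l2sum (val f))).

End L2.

Section Laplacian.
Variables (R : realType) (V : choiceType) (G : lfgraph V).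
Implicit Types f g : V -> R[i].

Local Notation d := (degree G).

(* The sum is finite by adj_lf, so the formula makes sense for every function,
   not only for the square-summable ones. *)
Definition adjacency_fun f : V -> R[i] := fun v =>
  \sum_(w \in neighbors G v) ((Num.sqrt ((d v)%:R * (d w)%:R))^-1)%:C * f w.

Definition laplacian_fun f : V -> R[i] := fun v => f v - adjacency_fun f v.

Lemma sqr_sum_le (T : eqType) (s : seq T) (b : T -> R) :
  (\sum_(i <- s) b i) ^+ 2 <= (size s)%:R * \sum_(i <- s) b i ^+ 2.
Proof.
elim: s => [|x s IH]; first by rewrite !big_nil expr0n mulr0.
rewrite !big_cons /= -natr1.
set S := \sum_(i <- s) b i; set Q := \sum_(i <- s) _.
have h : 2 * (b x * S) <= (size s)%:R * b x ^+ 2 + Q.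
  rewrite /S /Q -sum1_size natr_sum mulr_suml !mulr_sumr -big_split /=.
  apply: ler_sum => i _; have := sqr_ge0 (b x - b i); nra.
rewrite -/S -/Q in IH; nra.
Qed.

Lemma normc_sum (T : Type) (s : seq T) (F : T -> R[i]) :
  normc (\sum_(i <- s) F i) <= \sum_(i <- s) normc (F i).
Proof.
elim: s => [|x s IH]; first by rewrite !big_nil normc0.
by rewrite !big_cons (le_trans (le_normcD _ _))// lerD2l.
Qed.

Lemma normcR (x : R) : 0 <= x -> normc x%:C = x.
Proof. by move=> x0; rewrite /normc /= expr0n addr0 sqrtr_sqr ger0_norm. Qed.

Lemma adjacency_fun_le f v :
  normc (adjacency_fun f v) ^+ 2 <=
  \sum_(w \in neighbors G v) normc (f w) ^+ 2 / (d w)%:R.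
Proof.
have fin := adj_lf G v.
rewrite /adjacency_fun !fsbig_finite//= -/(neighbors G v).
rewrite (le_trans (y := (\sum_(w <- fset_set (neighbors G v))
   (Num.sqrt (d v)%:R)^-1 * (normc (f w) / Num.sqrt (d w)%:R)) ^+ 2))//.
  rewrite lerXn2r ?nnegrE ?normc_ge0//.
    by rewrite sumr_ge0// => w _; rewrite ?mulr_ge0 ?invr_ge0 ?sqrtr_ge0 ?normc_ge0.
  apply: le_trans (normc_sum _ _) _; apply: ler_sum => w _.
  rewrite normcM normcR ?invr_ge0 ?sqrtr_ge0// sqrtrM// invfM.
  by rewrite mulrCA mulrA mulrC mulrA.
apply: le_trans (sqr_sum_le _ _) _.
rewrite -/(d v) mulr_sumr; apply: ler_sum => w _.
rewrite !exprMn !exprVn !sqr_sqrtr// mulrA.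
have [->|dv] := eqVneq (d v) 0%N.
  by rewrite mul0r divr_ge0// sqr_ge0.
by rewrite !mulrA mulfV ?mul1r// pnatr_eq0.
Qed.

Lemma esum_swap (a : V -> V -> \bar R) : (forall v w, 0 <= a v w)%E ->
  (\esum_(v in [set: V]) \esum_(w in [set: V]) a v w =
   \esum_(w in [set: V]) \esum_(v in [set: V]) a v w)%E.
Proof.
move=> a0; rewrite !esum_esum//.
rewrite (@reindex_esum _ _ _ ([set: V] `*`` (fun=> [set: V])) _
  (fun k : V * V => (k.2, k.1)))//.
split=> //= [[x y] [x' y'] _ _ [-> ->]//|[x y] _].
by exists (y, x).
Qed.

Lemma l2sum_adjacency f : (l2sum (adjacency_fun f) <= l2sum f)%E.
Proof.
pose q w := normc (f w) ^+ 2 / (d w)%:R.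
have q0 w : (0 <= (q w)%:E)%E by rewrite lee_fin divr_ge0// sqr_ge0.
apply: (@le_trans _ _ (\esum_(v in [set: V]) \esum_(w in [set: V])
    if w \in neighbors G v then (q w)%:E else 0%E)%E).
  apply: le_esum => v _; rewrite -esum_mkcond esum_fset//; last exact: adj_lf.
  by rewrite fsumEFin ?lee_fin ?adjacency_fun_le//; exact: adj_lf.
rewrite esum_swap; last by move=> v w; case: ifP.
apply: le_esum => w _.
rewrite (_ : (fun v => _) =
  fun v => if v \in neighbors G w then (q w)%:E else 0%E); last first.
  apply/funext => v; congr (if _ then _ else _).
  by apply/idP/idP; rewrite !inE /neighbors /= adj_sym.
have fw := adj_lf G w.
rewrite -esum_mkcond esum_fset// fsumEFin// lee_fin fsbig_finite//=.
rewrite big_const_seq count_predT iter_addr_0 -/(d w) /q -[leLHS]mulr_natr.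
have [->|dw] := eqVneq (d w) 0%N; first by rewrite mulr0 sqr_ge0.
by rewrite divfK// pnatr_eq0.
Qed.

Lemma l2sum_laplacian f : (l2sum (laplacian_fun f) <= 4%:E * l2sum f)%E.
Proof.
rewrite (_ : laplacian_fun f = f + -1 *: adjacency_fun f); last first.
  by rewrite scaleN1r.
apply: le_trans (l2sumD _ _) _.
have -> : (4%:E = 2%:E * 2%:E :> \bar R)%E by rewrite -EFinM -natrM.
rewrite -muleA lee_wpmul2l ?lee_fin// mule_natl mule2n leeD2l//.
apply: le_trans (l2sumZ _ _) _.
by rewrite normcN normc1 expr1n mul1e l2sum_adjacency.
Qed.

Lemma laplacian_square_summable (f : l2 R V) :
  square_summable (laplacian_fun (val f)).
Proof.
apply: le_lt_trans (l2sum_laplacian _) _.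
by rewrite lte_mul_pinfty//; exact: (valP f).
Qed.

Definition laplacian (f : l2 R V) :
  l2 R V := exist (fun g => is_true (square_summable g)) _ (laplacian_square_summable f).

Lemma adjacency_fun_linear a f g v :
  adjacency_fun (a *: f + g) v = a * adjacency_fun f v + adjacency_fun g v.
Proof.
have fv : finite_set (neighbors G v) := adj_lf G v.
rewrite /adjacency_fun !(fsbig_finite _ _ fv) /= mulr_sumr -big_split /=.
by apply: eq_bigr => w _; rewrite -[(a *: f + g) w]/(a * f w + g w) mulrDr mulrCA.
Qed.

Lemma laplacian_fun_linear a f g :
  laplacian_fun (a *: f + g) = a *: laplacian_fun f + laplacian_fun g.
Proof.
apply/funext => v; rewrite /laplacian_fun adjacency_fun_linear.
rewrite -[LHS]/(a * f v + g v - (a * adjacency_fun f v + adjacency_fun g v)).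
rewrite -[RHS]/(a * (f v - adjacency_fun f v) + (g v - adjacency_fun g v)).
by rewrite mulrBr addrACA -opprD.
Qed.

Lemma laplacian_linear : linear laplacian.
Proof. by move=> a f g; apply/val_inj; exact: laplacian_fun_linear. Qed.

HB.instance Definition _ :=
  GRing.isLinear.Build R[i] (l2 R V) (l2 R V) *:%R laplacian laplacian_linear.

Lemma l2norm_laplacian (f : l2 R V) : l2norm (laplacian f) <= 2 * l2norm f.
Proof.
have fin (g : l2 R V) : l2sum (val g) \is a fin_num.
  by rewrite ge0_fin_numE ?l2sum_ge0//; exact: (valP g).
rewrite /l2norm -[2 in leRHS](@ger0_norm R 2)// -sqrtr_sqr -sqrtrM ?sqr_ge0//.
rewrite ler_wsqrtr// -lee_fin EFinM !fineK// (_ : 2 ^+ 2 = 4) ?l2sum_laplacian//.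
by rewrite expr2 -natrM.
Qed.

End Laplacian.

Section BoundedOperators.
Variables (R : realType) (V : choiceType).
Local Notation H := (l2 R V).

Lemma delta_subproof (v : V) :
  square_summable (fun w : V => (w == v)%:R : R[i]).
Proof.
rewrite /square_summable /l2sum.
rewrite (@eq_esum _ _ _ _ (fun w => if w \in [set v] then 1%E else 0%E)).
  by rewrite -esum_mkcond esum_set1 ?lee01// ltry.
move=> w _; have [->|wv] := eqVneq w v.
  by rewrite mem_set// normc1 expr1n.
by rewrite memNset ?normc0 ?expr0n//; exact/eqP.
Qed.

Definition delta (v : V) : H :=
  exist (fun g => is_true (square_summable g)) _ (delta_subproof v).

Definition bounded_operator : set {linear H -> H} :=
  [set T | exists M : R, forall f, l2norm (T f) <= M * l2norm f].

(* Meaningful for bounded operators only: sup is 0 on unbounded sets, which is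
   why boundedness is required separately in banded_closure. *)
Definition operator_norm (T : {linear H -> H}) : R :=
  sup [set l2norm (T f) | f in [set f | l2norm f <= 1]].

(* <T delta_w, delta_v> is the value of T delta_w at v. *)
Definition matrix_entry (T : {linear H -> H}) (v w : V) : R[i] := val (T (delta w)) v.

Definition banded (d : nat) : set {linear H -> H} :=
  [set T | [/\ bounded_operator T,
    forall v, ([set w | matrix_entry T v w != 0] #<= `I_d)%card &
    forall w, ([set v | matrix_entry T v w != 0] #<= `I_d)%card]].

Definition banded_oo : set {linear H -> H} := \bigcup_(d in [set: nat]) banded d.

(* Closure of banded_oo in the normed space of bounded operators. *)
Definition banded_closure : set {linear H -> H} :=
  [set T | bounded_operator T /\
    forall e : R, 0 < e ->
      exists2 S, banded_oo S & operator_norm (T \- S) < e].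

End BoundedOperators.

Lemma laplacian_bounded (R : realType) (V : choiceType) (G : lfgraph V) :
  bounded_operator (laplacian (R := R) G).
Proof. by exists 2; exact: l2norm_laplacian. Qed.

Definition AULF (R : realType) (V : choiceType) (G : lfgraph V) : Prop :=
  banded_closure (laplacian (R := R) G).

(* Main.v *)
Require Import Defs.
From HB Require Import structures.
From mathcomp Require Import all_boot all_order all_algebra finmap.
From mathcomp Require Import boolp classical_sets functions cardinality fsbigop.
From mathcomp Require Import reals ereal normedtype esum.
From mathcomp Require Import complex.
From mathcomp Require Import ring lra zify.

Set Implicit Arguments.
Unset Strict Implicit.
Unset Printing Implicit Defensive.

Import Order.TTheory GRing.Theory Num.Theory.
Import numFieldNormedType.Exports.
Import ComplexField.Normc.

Local Open Scope classical_set_scope.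
Local Open Scope ring_scope.

(** Why the criterion holds.

    On one component the Laplacian is the identity minus the normalized
    adjacency matrix, whose off-diagonal block is the k x l matrix with all
    entries 1 / sqrt (k l), a rank-one partial isometry between the constant
    functions of the two parts.  The Laplacian is therefore in the closure of
    the banded operators as soon as these constant matrices can be approximated,
    with an error uniform in the component, by matrices with boundedly many
    non-zero entries in each row and column.  If l / k is bounded, that is what
    expanders provide; if not, there is no such approximation.

    Bounded ratio.  An expander is seen as a family of permutations of a finite
    set whose average is close, as an operator, to the orthogonal projection onto
    the constants ([expanding]).  A family on K ^ t points, for all t, with a
    fixed number of permutations and a fixed error 1/4 is obtained by iterating
    the zig-zag product ([has_expander_zigzag]): squaring brings the error down
    to 1/16, and the product with a fixed seed brings the number of permutations
    back to its value.  The seed must have D permutations on D ^ 4 points and a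
    small error.  It comes from the plane V * V over a finite field
    with q elements: averages along parallel lines of distinct directions are
    projections which are orthogonal to each other off the constants, so
    averaging over q directions gives an error 1 / q by a Bessel inequality
    ([excess_bessel]), and each line may itself be replaced by an expander on V
    ([has_expander_plane]).  Every step squares the number of points but
    multiplies the number of permutations by q only.  Composing expanders makes
    the error as small as desired ([has_expander_small]).  Finally, K ^ t
    points, with t such that l <= K ^ t <= K l, are distributed evenly among the
    k left vertices and among the l right vertices; compressing the expander
    gives the required k x l matrix, and each fibre has bounded size because l / k
    is bounded ([sparse_bipartite]).  Replacing the blocks of the Laplacian by
    these matrices gives an operator which is banded ([approximant_banded]) and
    close to it ([approximant_close]).

    Unbounded ratio.  Let S have at most d non-zero entries in each row.
    On a component, the k left rows of S meet at most k d right columns, so S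
    sends the indicator of the remaining right vertices X to a function which
    vanishes on the left.  The Laplacian sends it to the constant
    - #|X| / sqrt (k l) there, of squared norm #|X| ^ 2 / l, to be compared with
    the squared norm #|X| of the indicator.  If S is within 1/2 of the Laplacian
    then #|X| <= l / 4, hence l <= 2 d k ([AULF_bounded_ratio]). *)

(** * Averages of permutations close to the mean *)

Section Expanders.
Variable R : realFieldType.
Implicit Types (V W I J : finType).

Definition sqnorm V (f : V -> R) : R := \sum_v f v ^+ 2.

Definition avgform V I (s : I -> V -> V) (g f : V -> R) : R :=
  #|I|%:R^-1 * \sum_i \sum_v g v * f (s i v).

Definition meanform V (g f : V -> R) : R :=
  #|V|%:R^-1 * ((\sum_v g v) * \sum_v f v).

(** The operator norm of the average of the permutations [s i] minus the
    projection onto the constants, bounded by [e] through its bilinear form.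
    The sum of the squared norms replaces twice their product: the two
    bounds are equivalent by rescaling [g] and [f], and this one can be added
    over the blocks of a block-diagonal form. *)
Definition expanding V I (s : I -> V -> V) (e : R) : Prop :=
  forall g f, 2 * (avgform s g f - meanform g f) <= e * (sqnorm g + sqnorm f).

Definition has_expander V I (e : R) : Prop :=
  exists2 s : I -> V -> V, (forall i, injective (s i)) & expanding s e.

Lemma sqnorm_ge0 V (f : V -> R) : 0 <= sqnorm f.
Proof. by apply: sumr_ge0 => v _; rewrite sqr_ge0. Qed.

(** The difference of the two sides is the variance of [F]. *)
Lemma sqr_mean_le I (F : I -> R) :
  (#|I|%:R^-1 * \sum_i F i) ^+ 2 <= #|I|%:R^-1 * \sum_i F i ^+ 2.
Proof.
have [I0|I0] := eqVneq #|I| 0%N; first by rewrite I0 invr0 !mul0r expr0n.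
set m := _ * \sum_i F i.
have nz : #|I|%:R != 0 :> R by rewrite pnatr_eq0.
have Sm : \sum_i F i = #|I|%:R * m by rewrite mulVKf.
have : 0 <= \sum_i (F i - m) ^+ 2 by apply: sumr_ge0 => i _; rewrite sqr_ge0.
have -> : \sum_i (F i - m) ^+ 2 = \sum_i F i ^+ 2 - #|I|%:R * m ^+ 2.
  have E i : (F i - m) ^+ 2 = F i ^+ 2 + (m ^+ 2 - (2 * m) * F i) by ring.
  under eq_bigr do rewrite E.
  by rewrite big_split sumrB /= -(mulr_sumr _ _ _ (2 * m)) Sm sumr_const -mulr_natl; ring.
by rewrite ler_pdivlMl ?ltr0n ?lt0n// subr_ge0.
Qed.

(** Averages of permutations are contractions: this convexity bound is what
    makes the untouched factors harmless in products of operators. *)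
Lemma sqnorm_mean V I (h : I -> V -> R) (c : R) : 0 <= c ->
  (forall i, sqnorm (h i) <= c) ->
  sqnorm (fun v => #|I|%:R^-1 * \sum_i h i v) <= c.
Proof.
move=> c0 hc; apply: (@le_trans _ _ (#|I|%:R^-1 * \sum_i sqnorm (h i))).
  rewrite exchange_big mulr_sumr; apply: ler_sum => v _; exact: sqr_mean_le.
have [I0|I0] := eqVneq #|I| 0%N; first by rewrite I0 invr0 mul0r.
rewrite ler_pdivrMl ?ltr0n ?lt0n// mulr_natl -sumr_const.
by apply: ler_sum => i _.
Qed.

Lemma sqnorm_inj V (s : V -> V) (f : V -> R) : injective s ->
  sqnorm (fun v => f (s v)) = sqnorm f.
Proof. by move=> sI; rewrite /sqnorm [RHS](reindex_inj sI). Qed.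

Lemma sqnormZ V (a : R) (f : V -> R) :
  sqnorm (fun v => a * f v) = a ^+ 2 * sqnorm f.
Proof. by rewrite /sqnorm mulr_sumr; under eq_bigr do rewrite exprMn. Qed.

Lemma sqnorm_pair V W (f : V * W -> R) :
  sqnorm f = \sum_v sqnorm (fun w => f (v, w)).
Proof. by rewrite /sqnorm pair_bigA; apply: eq_bigr => -[]. Qed.

Lemma card_eq_bij V W : #|V| = #|W| -> exists h : V -> W, bijective h.
Proof.
move=> cVW; exists (fun v => enum_val (cast_ord cVW (enum_rank v))).
exists (fun w => enum_val (cast_ord (esym cVW) (enum_rank w))) => x.
  by rewrite enum_valK cast_ordK enum_rankK.
by rewrite enum_valK cast_ordKV enum_rankK.
Qed.

(** Only the numbers of points and permutations matter, so that products and
    powers of types can be replaced by ordinals. *)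
Lemma has_expander_card V I V' I' e : #|V| = #|V'| -> #|I| = #|I'| ->
  has_expander V I e -> has_expander V' I' e.
Proof.
move=> cV cI [s sI se].
have [h hb] := card_eq_bij cV; have [m mb] := card_eq_bij (esym cI).
case: (hb) => h' hK h'K.
exists (fun i v => h (s (m i) (h' v))) => [i v w /(can_inj hK) /sI /(can_inj h'K)//|].
move=> g f; have := se (g \o h) (f \o h).
rewrite /avgform /meanform /sqnorm -cV -cI.
have sumh F : \sum_v F (h v) = \sum_v F v :> R.
  by rewrite [RHS](reindex h)//; exact: onW_bij.
rewrite !sumh -(sumh (fun v => g v ^+ 2)) -(sumh (fun v => f v ^+ 2)).
rewrite (reindex m) /=; last exact: onW_bij.
congr (2 * (_ * _ - _) <= _); apply: eq_bigr => i _.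
by rewrite -sumh; apply: eq_bigr => v _; rewrite hK.
Qed.

(** The averages and the projection onto the constants commute, with product
    the projection, so the deviation of the composite is the composite of the
    deviations. *)
Lemma has_expander_comp V I J a b : (0 < #|I|)%N -> (0 < #|J|)%N -> 0 <= a -> 0 < b ->
  has_expander V I a -> has_expander V J b -> has_expander V (I * J)%type (a * b).
Proof.
move=> I0 J0 a0 b0 [s sI sa] [t tI tb].
exists (fun ij v => t ij.2 (s ij.1 v)) => [[i j] v w /= /tI /sI//|g f].
set m := #|V|%:R^-1 * \sum_v f v.
pose A v := #|J|%:R^-1 * \sum_j f (t j v).
pose h v := A v - m.
have nzJ : #|J|%:R != 0 :> R by rewrite pnatr_eq0 -lt0n.
have avgA u : avgform t u f = \sum_v u v * A v.
  rewrite /avgform exchange_big mulr_sumr; apply: eq_bigr => v _.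
  by rewrite /A -mulr_sumr mulrCA.
have avgh u : avgform t u f - meanform u f = \sum_v u v * h v.
  rewrite avgA /meanform mulrCA -/m mulr_suml -sumrB.
  by apply: eq_bigr => v _; rewrite mulrBr.
have hle : sqnorm h <= b ^+ 2 * sqnorm f.
  (* Testing against h / b turns the bound on the form into one on the norm. *)
  have := tb (fun v => b^-1 * h v) f.
  rewrite avgh sqnormZ; under eq_bigr do rewrite -mulrA -expr2.
  rewrite -mulr_sumr -/(sqnorm h) => H.
  rewrite -(ler_pM2l (x := b^-1)) ?invr_gt0//.
  suff -> : b^-1 * (b ^+ 2 * sqnorm f) = b * sqnorm f.
    have e1 : b * (b^-1 ^+ 2 * sqnorm h + sqnorm f) = b^-1 * sqnorm h + b * sqnorm f.
      by field; rewrite gt_eqF.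
    by move: H; rewrite e1; lra.
  by field; rewrite gt_eqF.
have sumh : \sum_v h v = 0.
  have [V0|V0] := eqVneq #|V| 0%N.
    by rewrite big1// => v; have := max_card (pred1 v); rewrite card1 V0.
  rewrite sumrB sumr_const -mulr_natr /m mulrAC mulVf ?pnatr_eq0// mul1r.
  rewrite -mulr_sumr exchange_big /=.
  under eq_bigr => j _ do rewrite -(reindex_inj (tI j) (P := xpredT)) /=.
  by rewrite sumr_const -[(\sum_v f v) *+ _]mulr_natl mulKf ?subrr.
have -> : avgform (fun ij v => t ij.2 (s ij.1 v)) g f - meanform g f
    = avgform s g h - meanform g h.
  rewrite {2}/meanform sumh !mulr0 subr0 /avgform card_prod natrM invfM.
  rewrite /meanform mulrCA -/m.
  rewrite -(pair_bigA _ (fun i j => \sum_v g v * f (t j (s i v)))) /=.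
  have -> : \sum_i \sum_v g v * h (s i v) =
      \sum_i (\sum_v g v * A (s i v)) - #|I|%:R * ((\sum_v g v) * m).
    rewrite mulr_natl -sumr_const -sumrB; apply: eq_bigr => i _.
    by rewrite mulr_suml -sumrB; apply: eq_bigr => v _; rewrite mulrBr.
  rewrite mulrBr mulKf ?pnatr_eq0 -?lt0n// -mulrA; congr (_ * _ - _).
  rewrite mulr_sumr; apply: eq_bigr => i _.
  rewrite exchange_big mulr_sumr; apply: eq_bigr => v _.
  by rewrite /A -mulr_sumr mulrCA.
(* [h / b] has norm at most that of [f]; the factor [b] is recovered at the end. *)
have := sa g (fun v => b^-1 * h v).
rewrite sqnormZ.
have -> : avgform s g (fun v => b^-1 * h v) = b^-1 * avgform s g h.
  rewrite /avgform mulrCA; congr (_ * _); rewrite mulr_sumr.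
  apply: eq_bigr => i _; rewrite mulr_sumr.
  by apply: eq_bigr => v _; rewrite mulrCA.
have -> : meanform g (fun v => b^-1 * h v) = b^-1 * meanform g h.
  by rewrite /meanform -mulr_sumr; ring.
rewrite -mulrBr; set x := avgform _ _ _ - _ => sax.
have bh : b^-1 ^+ 2 * sqnorm h <= sqnorm f.
  by rewrite exprVn ler_pdivrMl ?exprn_gt0.
rewrite -(ler_pM2l (x := b^-1)) ?invr_gt0// mulrCA.
apply: le_trans sax _; rewrite [leRHS]mulrA [b^-1 * _]mulrCA mulVf ?mulr1 ?gt_eqF//.
by rewrite ler_wpM2l// lerD2l.
Qed.

(** * The zig-zag product *)

Lemma sqnorm_fibre_mean V I (g : V * I -> R) :
  #|I|%:R * sqnorm (fun v => #|I|%:R^-1 * \sum_i g (v, i)) <= sqnorm g.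
Proof.
rewrite sqnorm_pair /sqnorm mulr_sumr; apply: ler_sum => v _.
have [I0|I0] := eqVneq #|I| 0%N.
  by rewrite I0 mul0r sumr_ge0// => i _; rewrite sqr_ge0.
by rewrite -ler_pdivlMl ?ltr0n ?lt0n// sqr_mean_le.
Qed.

(** The new permutations move the label [i] by [t], then the point by [s i],
    then the label again.  Replacing either move of the label by the uniform
    average over all labels costs [b], because the other factors are contractions.
    What is left after both replacements is the average of the [s i] on
    the functions of the point alone, which is within [a] of the mean. *)
Lemma has_expander_zigzag V I J a b : (0 < #|I|)%N -> 0 <= a -> 0 <= b ->
  has_expander V I a -> has_expander I J b ->
  has_expander (V * I)%type (J * J)%type (a + 2 * b).
Proof.
move=> I0 a0 b0 [s sI sa] [t tI tb].
have nzI : #|I|%:R != 0 :> R by rewrite pnatr_eq0 -lt0n.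
exists (fun jj vi => (s (t jj.1 vi.2) vi.1, t jj.2 (t jj.1 vi.2))).
  by move=> [j j'] [v i] [w k] /= [+ /tI/tI ik]; rewrite ik => /sI ->.
move=> g f.
pose P' i := invF (sI i).
pose U h (x : V * I) := h (s x.2 x.1, x.2) : R.
pose Bf (x : V * I) := #|J|%:R^-1 * \sum_j f (x.1, t j x.2).
pose gm v := #|I|%:R^-1 * \sum_i g (v, i).
pose fm v := #|I|%:R^-1 * \sum_i f (v, i).
pose g2 (x : V * I) := gm (P' x.2 x.1).
have sum_fibres c (u w : V * I -> R) : 0 <= c ->
    sqnorm u <= sqnorm g -> sqnorm w <= sqnorm f ->
    c * (\sum_v (sqnorm (fun i => u (v, i)) + sqnorm (fun i => w (v, i)))) <=
    c * (sqnorm g + sqnorm f).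
  by move=> c0 ug wf; rewrite ler_wpM2l// big_split /= -!sqnorm_pair lerD.
have Bf_le : sqnorm Bf <= sqnorm f.
  apply: (sqnorm_mean (h := fun j x => f (x.1, t j x.2))) => [|j].
    exact: sqnorm_ge0.
  rewrite (sqnorm_inj (s := fun x => (x.1, t j x.2)))//.
  by move=> [v i] [w k] /= [-> /tI ->].
have UBf_le : sqnorm (U Bf) <= sqnorm f.
  apply: le_trans Bf_le; rewrite (sqnorm_inj (s := fun x => (s x.2 x.1, x.2)))//.
  by move=> [v i] [w k] /= [+ ik]; rewrite ik => /sI ->.
have g2_le : sqnorm g2 <= sqnorm g.
  apply: le_trans (sqnorm_fibre_mean g); rewrite sqnorm_pair /sqnorm exchange_big.
  rewrite mulr_natl -sumr_const; apply: ler_sum => i _.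
  by rewrite [leRHS](reindex_inj (can_inj (f_invF (sI i)))).
have -> : avgform (fun jj vi => (s (t jj.1 vi.2) vi.1, t jj.2 (t jj.1 vi.2))) g f
    = \sum_v avgform t (fun i => g (v, i)) (fun i => U Bf (v, i)).
  rewrite /avgform card_prod natrM invfM -mulr_sumr -mulrA; congr (_ * _).
  rewrite -(pair_bigA _ (fun j j' => \sum_x g x *
    f (s (t j x.2) x.1, t j' (t j x.2)))) /= mulr_sumr exchange_big /=.
  apply: eq_bigr => j _; rewrite [RHS]pair_bigA exchange_big mulr_sumr /=.
  by apply: eq_bigr => -[v i] _; rewrite /U /Bf /= -mulr_sumr mulrCA.
(* Replace the first move of the label by the mean over labels. *)
have first : 2 * \sum_v (avgform t (fun i => g (v, i)) (fun i => U Bf (v, i)) -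
    meanform (fun i => g (v, i)) (fun i => U Bf (v, i))) <=
    b * (sqnorm g + sqnorm f).
  apply: le_trans (sum_fibres b g (U Bf) b0 _ _) => //.
  by rewrite !mulr_sumr; apply: ler_sum => v _; exact: tb.
(* Replace the second one, in the form transported through the moves [s i]. *)
have second : 2 * \sum_v (avgform t (fun i => g2 (v, i)) (fun i => f (v, i)) -
    meanform (fun i => g2 (v, i)) (fun i => f (v, i))) <=
    b * (sqnorm g + sqnorm f).
  apply: le_trans (sum_fibres b g2 f b0 _ _) => //.
  by rewrite !mulr_sumr; apply: ler_sum => v _; exact: tb.
(* Only the fibre means [gm] and [fm] are left. *)
have third : 2 * (#|I|%:R * (avgform s gm fm - meanform gm fm)) <=
    a * (sqnorm g + sqnorm f).
  apply: (@le_trans _ _ (#|I|%:R * (a * (sqnorm gm + sqnorm fm)))).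
    by rewrite mulrCA ler_wpM2l// ?ler0n.
  by rewrite mulrCA ler_wpM2l// mulrDr lerD// sqnorm_fibre_mean.
have e1 : \sum_v meanform (fun i => g (v, i)) (fun i => U Bf (v, i)) =
    \sum_v avgform t (fun i => g2 (v, i)) (fun i => f (v, i)).
  under eq_bigr => v _ do rewrite /meanform mulrA -/(gm v) mulr_sumr.
  rewrite exchange_big /avgform -mulr_sumr [in RHS]exchange_big /=.
  transitivity (\sum_i \sum_v g2 (v, i) * Bf (v, i)).
    apply: eq_bigr => i _; rewrite [RHS](reindex_inj (sI i)).
    by apply: eq_bigr => v _; rewrite /g2 /U /P' /= invF_f.
  rewrite exchange_big pair_bigA mulr_sumr.
  under [RHS]eq_bigr => j _ do rewrite pair_bigA mulr_sumr.
  rewrite [RHS]exchange_big; apply: eq_bigr => -[v i] _.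
  by rewrite -mulr_sumr mulrCA -mulr_sumr.
have e2 : \sum_v meanform (fun i => g2 (v, i)) (fun i => f (v, i)) =
    #|I|%:R * avgform s gm fm.
  rewrite /avgform mulrA mulfV// mul1r.
  under eq_bigr => v _ do rewrite /meanform mulrCA -/(fm v) mulr_suml.
  rewrite exchange_big; apply: eq_bigr => i _.
  rewrite (reindex_inj (sI i)); apply: eq_bigr => v _.
  by rewrite /g2 /P' /= invF_f.
have e3 : #|I|%:R * meanform gm fm = meanform g f.
  have sumI (h : V * I -> R) :
      \sum_v #|I|%:R^-1 * \sum_i h (v, i) = #|I|%:R^-1 * \sum_x h x.
    by rewrite -mulr_sumr pair_bigA; congr (_ * _); apply: eq_bigr => -[].
  rewrite /meanform !sumI card_prod natrM invfM.
  by rewrite mulrACA mulrA mulrCA !mulrA mulfK//.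
move: third; rewrite mulrBr e3 -e2.
move: first second; rewrite !sumrB e1; lra.
Qed.


(** * Directions in a plane over a finite field *)

Lemma has_expander_translations (V : finZmodType) : has_expander V V 0.
Proof.
exists (fun u v => v + u) => [u v w /addIr//|g f].
suff -> : avgform (fun u v : V => v + u) g f = meanform g f.
  by rewrite subrr mulr0 mul0r.
rewrite /avgform /meanform exchange_big mulr_suml; congr (_ * _).
apply: eq_bigr => v _; rewrite -mulr_sumr; congr (_ * _).
by rewrite [RHS](reindex_inj (addrI v)).
Qed.

Section Plane.
Variables (F : finFieldType) (n : nat).
Local Notation V := 'rV[F]_n.
Local Notation N := (#|{: V}|%:R : R).
Local Notation q := (#|F|%:R : R).

(** The line of slope [x] and intercept [c], parametrized by its first
    coordinate; the coordinates range over a vector space rather than over [F],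
    so that there may be far fewer slopes than points on a line. *)
Definition line (f : V * V -> R) (x : F) (c : V) (a : V) : R := f (a, c + x *: a).

Lemma sum_lines (f : V * V -> R) x : \sum_c \sum_a line f x c a = \sum_v f v.
Proof.
transitivity (\sum_a \sum_b f (a, b)).
  rewrite exchange_big; apply: eq_bigr => a _.
  by rewrite [RHS](reindex_inj (addIr (x *: a))).
by rewrite pair_bigA; apply: eq_bigr => -[].
Qed.

(** Two lines of distinct slopes meet in exactly one point, so the pairs of
    intercepts are coordinates on the plane. *)
Lemma sum_crossing_lines (u w : V -> R) (x y : F) : x != y ->
  \sum_(ab : V * V) u (ab.2 - x *: ab.1) * w (ab.2 - y *: ab.1) =
  (\sum_c u c) * \sum_c w c.
Proof.
move=> xy; pose h (ab : V * V) := (ab.2 - x *: ab.1, ab.2 - y *: ab.1).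
have hI : injective h.
  move=> [a b] [a' b'] [e1 e2].
  have /eqP : (x - y) *: (a - a') = 0.
    rewrite scalerBr !scalerBl.
    have E (c d : V) : x *: c - y *: c = (d - y *: c) - (d - x *: c).
      by rewrite opprB [RHS]addrC addrA subrK.
    by rewrite (E a b) (E a' b') e1 e2 subrr.
  rewrite scaler_eq0 !subr_eq0 (negPf xy) /= => /eqP aa; move: e1.
  by rewrite aa => /addIr ->.
rewrite mulr_suml; under [RHS]eq_bigr do rewrite mulr_sumr.
by rewrite pair_bigA [RHS](reindex_inj hI).
Qed.

(** Divided by the number of points of a line, this is the value on the line
    of the projection of [f] onto the mean-zero functions constant on the
    lines of slope [x]. *)
Definition excess (f : V * V -> R) (x : F) (c : V) : R :=
  \sum_a line f x c a - N^-1 * \sum_v f v.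

Lemma N_neq0 : N != 0.
Proof. by rewrite pnatr_eq0 -lt0n; apply/card_gt0P; exists 0. Qed.

Lemma sum_excess f x : \sum_c excess f x c = 0.
Proof.
rewrite sumrB sum_lines sumr_const -[_ *+ _]mulr_natl.
by rewrite mulVKf ?N_neq0// subrr.
Qed.

(** The projections of [f] described by [excess], for the different slopes,
    are orthogonal to each other since lines of distinct slopes cross; this is
    their Bessel inequality, proved by expanding the square of [f] minus the sum
    of its projections. *)
Lemma excess_bessel f : \sum_x \sum_c excess f x c ^+ 2 <= N * sqnorm f.
Proof.
set Q := \sum_x _.
pose psi (v : V * V) := \sum_x excess f x (v.2 - x *: v.1).
have f_psi : \sum_v f v * psi v = Q.
  under eq_bigr do rewrite mulr_sumr.
  rewrite exchange_big; apply: eq_bigr => x _ /=.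
  rewrite -(sum_lines (fun v => f v * excess f x (v.2 - x *: v.1)) x).
  transitivity (\sum_c (\sum_a line f x c a) * excess f x c).
    apply: eq_bigr => c _; rewrite mulr_suml; apply: eq_bigr => a _.
    by rewrite /line /= addrK.
  rewrite [RHS](_ : _ = \sum_c (\sum_a line f x c a) * excess f x c
     - (N^-1 * \sum_v f v) * \sum_c excess f x c).
    by rewrite sum_excess mulr0 subr0.
  by rewrite mulr_sumr -sumrB; apply: eq_bigr => c _; rewrite -mulrBl expr2.
have psi_psi : sqnorm psi = N * Q.
  rewrite /sqnorm.
  transitivity (\sum_x \sum_y \sum_(v : V * V)
      excess f x (v.2 - x *: v.1) * excess f y (v.2 - y *: v.1)).
    under eq_bigr do rewrite expr2 mulr_suml.
    rewrite exchange_big; apply: eq_bigr => x _.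
    by rewrite exchange_big; apply: eq_bigr => v _; rewrite mulr_sumr.
  rewrite mulr_sumr; apply: eq_bigr => x _.
  rewrite (bigD1 x)//= [X in _ + X]big1 ?addr0 => [|y yx]; last first.
    by rewrite sum_crossing_lines 1?eq_sym// sum_excess mul0r.
  rewrite -(sum_lines _ x) exchange_big mulr_natl -sumr_const.
  apply: eq_bigr => a _; apply: eq_bigr => c _.
  by rewrite /line /= addrK expr2.
have : 0 <= sqnorm (fun v => f v - N^-1 * psi v) by exact: sqnorm_ge0.
rewrite {1}/sqnorm.
have E v : (f v - N^-1 * psi v) ^+ 2 =
  f v ^+ 2 - (2 * N^-1) * (f v * psi v) + N^-1 ^+ 2 * psi v ^+ 2 by ring.
under eq_bigr do rewrite E.
rewrite big_split sumrB /= -!mulr_sumr f_psi -!/(sqnorm _) psi_psi.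
rewrite expr2 -!mulrA mulKf ?N_neq0// => h.
rewrite -ler_pdivrMl ?ltr0n; first lra.
by rewrite lt0n -(pnatr_eq0 R) N_neq0.
Qed.

(** Moving along a line by [t], with a random slope.  Replacing [t] by the mean
    on every line costs [e]; the average over the slopes of the means along lines
    deviates from the global mean by the average of [#|F|] mutually orthogonal
    projections, whose norm is at most [#|F|^-1]. *)
Lemma has_expander_plane I e : 0 <= e ->
  has_expander V I e -> has_expander (V * V)%type (F * I)%type (e + q^-1).
Proof.
move=> e0 [t tI te].
exists (fun xi ab => (t xi.2 ab.1, ab.2 + xi.1 *: (t xi.2 ab.1 - ab.1))).
  by move=> [x i] [a b] [a' b'] /= [/tI <- /addIr ->].
move=> g f.
have q0 : q != 0 by rewrite pnatr_eq0 -lt0n; apply/card_gt0P; exists 0.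
pose mean_lines := q^-1 * \sum_x \sum_c meanform (line g x c) (line f x c).
have split_lines : avgform (fun xi ab =>
      (t xi.2 ab.1, ab.2 + xi.1 *: (t xi.2 ab.1 - ab.1))) g f =
    q^-1 * \sum_x \sum_c avgform t (line g x c) (line f x c).
  rewrite /avgform card_prod natrM invfM -mulrA; congr (_ * _).
  rewrite -(pair_bigA _ (fun x i => \sum_ab g ab *
     f (t i ab.1, ab.2 + x *: (t i ab.1 - ab.1)))) /= mulr_sumr.
  apply: eq_bigr => x _; rewrite -mulr_sumr [in RHS]exchange_big; congr (_ * _).
  apply: eq_bigr => i _; rewrite -(sum_lines _ x).
  apply: eq_bigr => c _; apply: eq_bigr => a _.
  by rewrite /line /= scalerBr -addrA [x *: a + _]addrC subrK.
have sq_lines h x : \sum_c sqnorm (line h x c) = sqnorm h.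
  exact: (sum_lines (fun v => h v ^+ 2) x).
have along : 2 * (q^-1 * \sum_x \sum_c avgform t (line g x c) (line f x c)
     - mean_lines) <= e * (sqnorm g + sqnorm f).
  rewrite -mulrBr mulrCA -sumrB ler_pdivrMl ?lt0r ?q0 ?ler0n//.
  rewrite [leRHS]mulr_natl -sumr_const mulr_sumr; apply: ler_sum => x _.
  rewrite -sumrB -!(sq_lines _ x) -big_split !mulr_sumr.
  by apply: ler_sum => c _; exact: te.
have line_means x : \sum_c meanform (line g x c) (line f x c) - meanform g f =
    N^-1 * \sum_c excess g x c * excess f x c.
  rewrite /meanform -mulr_sumr card_prod natrM invfM -mulrA -mulrBr.
  congr (_ * _).
  rewrite [RHS](_ : _ = \sum_c ((\sum_a line g x c a) * excess f x c)
     - N^-1 * (\sum_v g v) * \sum_c excess f x c); last first.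
    by rewrite mulr_sumr -sumrB; apply: eq_bigr => c _; rewrite -mulrBl.
  rewrite sum_excess mulr0 subr0.
  under [RHS]eq_bigr do rewrite mulrBr.
  by rewrite sumrB -mulr_suml sum_lines [_ * (N^-1 * _)]mulrCA.
have across : 2 * (mean_lines - meanform g f) <= q^-1 * (sqnorm g + sqnorm f).
  have -> : mean_lines - meanform g f =
      q^-1 * \sum_x (N^-1 * \sum_c excess g x c * excess f x c).
    under eq_bigr do rewrite -line_means.
    rewrite sumrB sumr_const mulrBr -[meanform g f *+ _]mulr_natl; congr (_ - _).
    by rewrite mulKf.
  rewrite mulrCA ler_wpM2l ?invr_ge0 ?ler0n// -mulr_sumr mulrCA.
  rewrite ler_pdivrMl ?lt0r ?N_neq0 ?ler0n// mulrDr.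
  apply: le_trans (lerD (excess_bessel g) (excess_bessel f)).
  rewrite -big_split mulr_sumr; apply: ler_sum => x _ /=.
  rewrite -big_split mulr_sumr; apply: ler_sum => c _ /=.
  by have := sqr_ge0 (excess g x c - excess f x c); lra.
move: along across; rewrite split_lines; lra.
Qed.
End Plane.

End Expanders.

(** * Expanders of bounded degree *)

Section Family.
Variable R : realFieldType.

Lemma has_expanderW (V I : finType) (a b : R) : a <= b ->
  has_expander V I a -> has_expander V I b.
Proof.
move=> ab [s sI sa]; exists s => // g f; apply: le_trans (sa g f) _.
by rewrite ler_wpM2r// addr_ge0// sqnorm_ge0.
Qed.

(** Three applications of [has_expander_plane], from all translations of a
    space of dimension 3: the numbers of points are the powers 3, 6, 12, 24 of
    [#|F|] while those of permutations are the powers 3, 4, 5, 6.  Dimension 3 is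
    the one for which the last two exponents have the ratio 4 that the
    zig-zag iteration asks for. *)
Lemma has_expander_plane3 (F : finFieldType) :
  has_expander 'I_((#|F| ^ 6) ^ 4) 'I_(#|F| ^ 6) (3 / #|F|%:R : R).
Proof.
have double n (I : finType) (e : R) : 0 <= e -> has_expander 'rV[F]_n I e ->
    has_expander 'rV[F]_(n + n) (F * I)%type (e + #|F|%:R^-1).
  move=> e0 h; apply: has_expander_card (has_expander_plane e0 h) => //.
  by rewrite card_prod !card_mx -expnD !mul1n.
have i0 : 0 <= #|F|%:R^-1 :> R by rewrite invr_ge0 ler0n.
have := @has_expander_translations R 'rV[F]_3.
move=> /(double _ _ _ (lexx 0)) /double h.
have {}h := double _ _ _ _ (h _).
apply: has_expanderW (has_expander_card _ _ (h _ _)).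
- by rewrite mulrC !mulrDr; lra.
- by rewrite card_mx card_ord mul1n -expnM.
- by rewrite !card_prod card_mx card_ord -!expnS.
- by rewrite add0r addr_ge0.
- by rewrite add0r.
Qed.

(** The error [3 / 32] is the largest [b] with [4^-1 ^+ 2 + 2 * b <= 4^-1], and
    37 is the first prime above 32. *)
Lemma has_expander_seed : exists2 D : nat, (1 < D)%N &
  has_expander 'I_(D ^ 4) 'I_D (3 / 32 : R).
Proof.
exists (#|'F_37| ^ 6)%N; first by rewrite card_Fp// -{1}(expn0 37) ltn_exp2l.
apply: has_expanderW (has_expander_plane3 _).
by rewrite card_Fp// ler_pM2l ?ltr0n// lef_pV2 ?posrE ?ltr0n// ler_nat.
Qed.

(** Starting from a single point, square the current expander, which gives it
    [D ^ 4] permutations and error [1 / 16], and take its zig-zag product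
    with the seed, which restores [D * D] permutations and error [1 / 4]. *)
Lemma has_expander_family : exists K d : nat, [/\ (1 < K)%N, (0 < d)%N &
  forall t, has_expander 'I_(K ^ t) 'I_d (4^-1 : R)].
Proof.
have [D D1 seed] := has_expander_seed.
have D0 : (0 < D)%N by apply: ltn_trans D1.
exists (D ^ 4)%N, (D * D)%N; split; first by rewrite -(expn0 D) ltn_exp2l.
  by rewrite muln_gt0 D0.
elim=> [|t IH].
  rewrite expn0; exists (fun _ v => v) => [i v w //|g f].
  rewrite /avgform /meanform /sqnorm !big_ord1 sumr_const !card_ord.
  rewrite -[(g ord0 * _) *+ _]mulr_natl mulKf.
    by rewrite invr1 mul1r subrr mulr0 mulr_ge0 ?invr_ge0 ?addr_ge0 ?sqr_ge0.
  by rewrite pnatr_eq0 -lt0n muln_gt0 D0.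
have dd : (0 < #|'I_(D * D)|)%N by rewrite card_ord muln_gt0 D0.
have IH2 : has_expander 'I_((D ^ 4) ^ t) 'I_(D ^ 4) (4^-1 * 4^-1 : R).
  apply: has_expander_card (has_expander_comp dd dd _ _ IH IH);
    rewrite ?invr_ge0 ?invr_gt0 ?ler0n ?ltr0n//.
  by rewrite card_prod !card_ord !expnS expn0 !mulnA muln1.
have D4 : (0 < #|'I_(D ^ 4)|)%N by rewrite card_ord expn_gt0 D0.
have a0 : 0 <= 4^-1 * 4^-1 :> R by rewrite mulr_ge0 ?invr_ge0 ?ler0n.
have b0 : 0 <= 3 / 32 :> R by rewrite divr_ge0 ?ler0n.
have h := has_expander_zigzag D4 a0 b0 IH2 seed.
apply: (has_expanderW _ (has_expander_card _ _ h)); first lra.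
  by rewrite card_prod !card_ord -expnSr.
by rewrite card_prod !card_ord.
Qed.

Lemma has_expander_family_pow m : exists K d : nat, [/\ (1 < K)%N, (0 < d)%N &
  forall t, has_expander 'I_(K ^ t) 'I_d (4^-1 ^+ m.+1 : R)].
Proof.
have [K [d [K1 d0 Kd]]] := has_expander_family.
exists K, (d ^ m.+1)%N; split=> //; first by rewrite expn_gt0 d0.
move=> t; elim: m => [|m IH]; first by rewrite expn1 expr1.
rewrite [in X in has_expander _ _ X]exprS.
have := has_expander_comp _ _ _ _ (Kd t) IH.
move=> h; apply: has_expander_card (h _ _ _ _) => //;
  by rewrite ?card_prod ?card_ord ?expnS ?muln_gt0 ?expn_gt0 ?d0
    ?exprn_gt0 ?invr_ge0 ?invr_gt0 ?ler0n ?ltr0n.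
Qed.
End Family.

Lemma has_expander_small (R : realType) (e : R) : 0 < e ->
  exists K d : nat, [/\ (1 < K)%N, (0 < d)%N &
    forall t, has_expander 'I_(K ^ t) 'I_d e].
Proof.
move=> e0; have [m me] : exists m : nat, 4^-1 ^+ m.+1 <= e.
  exists (Num.truncn e^-1).
  rewrite exprVn -lef_pV2 ?posrE ?invr_gt0 ?exprn_gt0// invrK.
  apply: le_trans (ltW (truncnS_gt _)) _.
  by rewrite -natrX ler_nat ltnW// ltn_expl.
have [K [d [K1 d0 Kd]]] := has_expander_family_pow R m.
by exists K, d; split=> // t; exact: has_expanderW (Kd t).
Qed.

(** * Sparse approximation of constant matrices *)

(** Reduction modulo [k].  The fibres have at least [N %/ k] points, and
    [N < 2 * (k * (N %/ k))] because [k <= N]. *)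
Lemma balanced_map (N k : nat) : (0 < k)%N -> (k <= N)%N ->
  exists alpha : 'I_N -> 'I_k, forall i,
    (N <= 2 * (k * #|[pred x | alpha x == i]|))%N /\
    (#|[pred x | alpha x == i]| <= (N %/ k).+1)%N.
Proof.
move=> k0 kN; exists (fun x => Ordinal (ltn_pmod x k0)) => i.
set A := [pred x | _]; split.
  have qA : (N %/ k <= #|A|)%N.
    have lt_qk (q : 'I_(N %/ k)) : (q * k + i < N)%N.
      apply: (@leq_trans (q.+1 * k)); first by rewrite mulSn addnC ltn_add2r.
      by apply: leq_trans (leq_trunc_div N k); rewrite leq_mul2r ltn_ord orbT.
    rewrite -[leqLHS]card_ord.
    have inj : injective (fun q => Ordinal (lt_qk q)).
      by move=> q r [/eqP]; rewrite eqn_add2r eqn_pmul2r// => /eqP/val_inj.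
    rewrite -(fintype.card_image inj); apply: subset_leq_card.
    apply/fintype.subsetP => _ /fintype.imageP[q _ ->]; rewrite inE -val_eqE /=.
    by rewrite modnMDl modn_small.
  have q1 : (1 <= N %/ k)%N by rewrite divn_gt0.
  apply: (@leq_trans (2 * (k * (N %/ k)))); last by rewrite !leq_mul2l qA !orbT.
  rewrite {1}(divn_eq N k) mul2n -addnn mulnC leq_add2l.
  by apply: leq_trans (ltnW (ltn_pmod _ k0)) _; rewrite leq_pmulr.
rewrite -[leqRHS]card_ord.
have lt_div (x : 'I_N) : (x %/ k < (N %/ k).+1)%N.
  by rewrite ltnS leq_div2r// ltnW.
pose h (x : 'I_N) := Ordinal (lt_div x).
rewrite -(@fintype.card_in_image _ _ h A) ?max_card// => x y.
rewrite !inE -!val_eqE /= => /eqP xi /eqP yi [e].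
by apply: val_inj; rewrite /= (divn_eq x k) (divn_eq y k) e xi yi.
Qed.

Section Compress.
Variables (R : realType) (V : finType).
Local Notation N := (#|V|%:R : R).

Definition fibre_size (A : finType) (alpha : V -> A) (i : A) : nat :=
  #|[pred x | alpha x == i]|.

(** The function on [V] that gives each fibre its value of [g], divided by the
    size of the fibre and scaled so that constant functions keep their norm once
    projected onto the constants.  Dividing by the size makes the total of
    [spread g] a multiple of the total of [g] even when the fibres are uneven. *)
Definition spread (A : finType) (alpha : V -> A) (g : A -> R) (x : V) : R :=
  Num.sqrt (N / #|A|%:R) / (fibre_size alpha (alpha x))%:R * g (alpha x).

Section Spread.
Variables (A : finType) (alpha : V -> A).
Hypothesis fibre_ge : forall i, (#|V| <= 2 * (#|A| * fibre_size alpha i))%N.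

Lemma sum_fibres (h : A -> R) :
  \sum_x h (alpha x) = \sum_i (fibre_size alpha i)%:R * h i.
Proof.
rewrite (partition_big alpha xpredT)//=; apply: eq_bigr => i _.
rewrite (eq_bigr (fun=> h i)); first by rewrite sumr_const mulr_natl.
by move=> x /eqP ->.
Qed.

Lemma sum_spread (g : A -> R) : (0 < #|V|)%N ->
  \sum_x spread alpha g x = Num.sqrt (N / #|A|%:R) * \sum_i g i.
Proof.
move=> V0; rewrite (sum_fibres (fun i => _ / (fibre_size alpha i)%:R * g i)).
rewrite mulr_sumr; apply: eq_bigr => i _.
have [f0|f0] := eqVneq (fibre_size alpha i) 0%N.
  by have := fibre_ge i; rewrite f0 !muln0 leqNgt V0.
by rewrite mulrA mulrCA mulfV ?mulr1// pnatr_eq0.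
Qed.

Lemma sqnorm_spread (g : A -> R) : sqnorm (spread alpha g) <= 2 * sqnorm g.
Proof.
rewrite /sqnorm.
rewrite (sum_fibres (fun i => (_ / (fibre_size alpha i)%:R * g i) ^+ 2)).
rewrite mulr_sumr; apply: ler_sum => i _; set a := (fibre_size alpha i).
have [a0|a0] := posnP a; first by rewrite a0 mul0r mulr_ge0// sqr_ge0.
have A0 : 0 < #|A|%:R :> R by rewrite ltr0n; apply/card_gt0P; exists i.
rewrite exprMn mulrA ler_wpM2r ?sqr_ge0// exprMn sqr_sqrtr ?divr_ge0 ?ler0n//.
rewrite [leLHS](_ : _ = N / (#|A|%:R * a%:R)); last first.
  by field; rewrite gt_eqF ?ltr0n// gt_eqF.
rewrite ler_pdivrMr; last by rewrite mulr_gt0// ltr0n.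
by rewrite -!natrM ler_nat fibre_ge.
Qed.
End Spread.

Section Matrix.
Variables (I A B : finType) (s : I -> V -> V) (alpha : V -> A) (beta : V -> B).
Hypothesis s_inj : forall i, injective (s i).

(** The matrix whose bilinear form is that of the average of [s] on the
    functions [spread alpha g] and [spread beta f]. *)
Definition compressed (i : A) (j : B) : R :=
  avgform s (spread alpha (fun i' => (i' == i)%:R))
            (spread beta (fun j' => (j' == j)%:R)).

Lemma compressed_form (g : A -> R) (f : B -> R) :
  \sum_i \sum_j g i * compressed i j * f j =
  avgform s (spread alpha g) (spread beta f).
Proof.
have spreadE (E : finType) (gamma : V -> E) h x :
    spread gamma h x = \sum_i h i * spread gamma (fun i' => (i' == i)%:R) x.
  rewrite (bigD1 (gamma x))//= big1 ?addr0 /spread ?eqxx ?mulr1 1?mulrC//.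
  by move=> i /negPf ix; rewrite eq_sym ix !mulr0.
transitivity (\sum_i \sum_j #|I|%:R^-1 * \sum_c \sum_v
    (g i * spread alpha (fun i' => (i' == i)%:R) v) *
    (f j * spread beta (fun j' => (j' == j)%:R) (s c v))).
  apply: eq_bigr => i _; apply: eq_bigr => j _.
  rewrite /compressed /avgform mulrAC mulrCA; congr (_ * _).
  rewrite mulr_sumr; apply: eq_bigr => c _; rewrite mulr_sumr.
  by apply: eq_bigr => v _; rewrite mulrACA.
under eq_bigr do rewrite -mulr_sumr.
rewrite -mulr_sumr; congr (_ * _).
under eq_bigr do rewrite exchange_big.
rewrite exchange_big; apply: eq_bigr => c _ /=.
under eq_bigr do rewrite exchange_big.
rewrite exchange_big; apply: eq_bigr => v _ /=.
rewrite [in RHS]spreadE [in X in _ * X]spreadE mulr_suml.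
by apply: eq_bigr => i _; rewrite mulr_sumr.
Qed.

(** A non-zero entry is witnessed by a permutation sending a point over [i] to a
    point over [j]; this bounds the entries of a row or column by the number of
    permutations times the size of a fibre. *)
Lemma compressed_neq0 i j : compressed i j != 0 ->
  exists cx : I * V, alpha cx.2 = i /\ beta (s cx.1 cx.2) = j.
Proof.
move=> ij; have /existsP[cx /andP[/eqP xi /eqP xj]] :
    [exists cx : I * V, (alpha cx.2 == i) && (beta (s cx.1 cx.2) == j)].
  apply: contraNT ij => /existsPn h; apply/eqP.
  rewrite /compressed /avgform pair_bigA big1 ?mulr0// => -[c x] _.
  rewrite /spread /=; have /nandP[/negPf->|/negPf->] := h (c, x);
    by rewrite !mulr0 ?mul0r.
by exists cx.
Qed.

Lemma compressed_row i :
  (#|[pred j | compressed i j != 0%R]| <= #|I| * fibre_size alpha i)%N.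
Proof.
rewrite -cardX.
set D := [predX _ & _].
apply: leq_trans _ (leq_image_card (fun cx => beta (s cx.1 cx.2)) D).
apply: subset_leq_card; apply/fintype.subsetP => j; rewrite inE.
move=> /compressed_neq0[cx [xi <-]]; apply: fintype.image_f.
by rewrite !inE xi eqxx.
Qed.

Lemma compressed_col j :
  (#|[pred i | compressed i j != 0%R]| <= #|I| * fibre_size beta j)%N.
Proof.
pose f (cy : I * V) := alpha (invF (@s_inj cy.1) cy.2).
rewrite -cardX.
set D := [predX _ & _].
apply: leq_trans _ (leq_image_card f D).
apply: subset_leq_card; apply/fintype.subsetP => i; rewrite inE.
move=> /compressed_neq0[[c x] /= [<- xj]]; apply/fintype.imageP.
by exists (c, s c x); rewrite ?inE ?xj ?eqxx// /f /= invF_f.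
Qed.
End Matrix.
End Compress.

(** The bound [m] depends on [e] and [C] only, which is what makes the
    approximation uniform over the components of a graph. *)
Lemma sparse_bipartite (R : realType) (e : R) (C : nat) : 0 < e ->
  exists m : nat, forall k l, (0 < k)%N -> (k <= l)%N -> (l <= C * k)%N ->
    exists B : 'I_k -> 'I_l -> R,
    [/\ forall i, (#|[pred j | B i j != 0%R]| <= m)%N,
        forall j, (#|[pred i | B i j != 0%R]| <= m)%N &
        forall g f, 2 * (\sum_i \sum_j g i * B i j * f j -
            (Num.sqrt (k%:R * l%:R))^-1 * ((\sum_i g i) * \sum_j f j)) <=
          e * (sqnorm g + sqnorm f)].
Proof.
move=> e0; have [K [d [K1 d0 exp]]] := has_expander_small (divr_gt0 e0 (ltr0Sn R 1)).
exists (d * (K * C).+1)%N => k l k0 kl lC.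
have l0 : (0 < l)%N by apply: leq_trans kl.
(* The sizes [K ^ t] are lacunary, but they meet every interval [l, K * l]. *)
pose t := up_log K l; pose N := (K ^ t)%N.
have lN : (l <= N)%N by exact: up_logP.
have NK : (N <= K * l)%N.
  have [l1|l1] := eqVneq l 1%N.
    by rewrite /N /t l1 up_log1 expn0 muln1 ltnW.
  have l_gt1 : (1 < l)%N by rewrite ltn_neqAle eq_sym l1.
  rewrite /N -(prednK (_ : 0 < t)%N) ?up_log_gt0 ?K1// expnS leq_mul2l.
  by rewrite ltnW ?orbT// up_log_gtn.
have N0 : (0 < N)%N by apply: leq_trans lN.
have [alpha Ha] := balanced_map k0 (leq_trans kl lN).
have [beta Hb] := balanced_map l0 lN.
have [s sI sexp] := exp t.
have fa i : (#|'I_N| <= 2 * (#|'I_k| * fibre_size alpha i))%N.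
  by rewrite !card_ord; have [] := Ha i.
have fb j : (#|'I_N| <= 2 * (#|'I_l| * fibre_size beta j))%N.
  by rewrite !card_ord; have [] := Hb j.
have Nk : (N %/ k <= K * C)%N.
  rewrite -[leqRHS](mulnK _ k0) leq_div2r//.
  by apply: leq_trans NK _; rewrite -mulnA leq_mul2l lC orbT.
exists (compressed R s alpha beta); split=> [i|j|g f].
- apply: leq_trans (compressed_row R s alpha beta i) _;rewrite card_ord leq_mul2l.
  by have [_ h] := Ha i; rewrite (leq_trans h) ?orbT.
- apply: leq_trans (compressed_col R alpha beta sI j) _; rewrite card_ord leq_mul2l.
  have [_ h] := Hb j; rewrite (leq_trans h) ?orbT// ltnS.
  by apply: leq_trans Nk; rewrite leq_div2l.
rewrite compressed_form.
have -> : (Num.sqrt (k%:R * l%:R))^-1 * ((\sum_i g i) * \sum_j f j) =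
    meanform (spread alpha g) (spread beta f) :> R.
  have roots : Num.sqrt (N%:R / k%:R) * Num.sqrt (N%:R / l%:R) =
      N%:R * (Num.sqrt (k%:R * l%:R))^-1 :> R.
    rewrite -sqrtrM ?divr_ge0 ?ler0n// mulrACA -invfM -expr2.
    by rewrite (sqrtrM _ (sqr_ge0 _)) sqrtr_sqr ger0_norm// sqrtrV// mulr_ge0.
  rewrite /meanform (sum_spread fa) ?(sum_spread fb) !card_ord// mulrACA roots.
  by rewrite -[in RHS]mulrA mulKf// pnatr_eq0 -lt0n.
apply: le_trans (sexp _ _) _.
rewrite -mulrA ler_wpM2l//; first exact: ltW.
by rewrite ler_pdivrMl// mulrDr lerD// sqnorm_spread.
Qed.

(** * Operators on square-summable functions *)

(** Testing the form against [T f / c] gives the norm; for [c = 0], against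
    [T f] itself. *)
Lemma sqnorm_form_bound (R : realFieldType) (X : finType)
    (T : (X -> R) -> X -> R) (c : R) : 0 <= c ->
  (forall g f, 2 * (\sum_x g x * T f x) <= c * (sqnorm g + sqnorm f)) ->
  forall f, sqnorm (T f) <= c ^+ 2 * sqnorm f.
Proof.
move=> c0 h f.
have sq : \sum_x T f x * T f x = sqnorm (T f).
  by apply: eq_bigr => x _; rewrite expr2.
have [cz|cn] := eqVneq c 0.
  have := h (T f) f; rewrite sq cz !mul0r expr0n mul0r.
  by rewrite pmulr_rle0 ?ltr0n.
have cp : 0 < c by rewrite lt0r cn.
have := h (fun x => c^-1 * T f x) f; rewrite sqnormZ.
under eq_bigr do rewrite -mulrA.
rewrite -mulr_sumr sq => H.
rewrite -(ler_pM2l (x := c^-1)) ?invr_gt0//.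
have -> : c^-1 * (c ^+ 2 * sqnorm f) = c * sqnorm f by field.
have e1 : c * (c^-1 ^+ 2 * sqnorm (T f) + sqnorm f) =
  c^-1 * sqnorm (T f) + c * sqnorm f by field.
move: H; rewrite e1; lra.
Qed.

Section L2.
Local Open Scope complex_scope.
Variables (R : realType) (V : choiceType).
Implicit Types f g : l2 R V.

Lemma l2norm_ge0 f : 0 <= l2norm f.
Proof. exact: sqrtr_ge0. Qed.

Lemma sqr_l2norm f : (l2norm f ^+ 2)%:E = l2sum (val f).
Proof.
have fin : l2sum (val f) \is a fin_num.
  by rewrite ge0_fin_numE ?l2sum_ge0//; exact: (valP f).
by rewrite /l2norm sqr_sqrtr ?fine_ge0 ?l2sum_ge0// fineK.
Qed.

Lemma l2norm_leP f g (c : R) : 0 <= c ->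
  (l2norm f <= c * l2norm g) <-> (l2sum (val f) <= (c ^+ 2)%:E * l2sum (val g))%E.
Proof.
move=> c0; rewrite -!sqr_l2norm -EFinM lee_fin -exprMn.
by rewrite ler_sqr ?nnegrE ?mulr_ge0 ?l2norm_ge0.
Qed.

Lemma l2normZ_le (a : R) f : 0 <= a -> l2norm (a%:C *: f) <= a * l2norm f.
Proof.
move=> a0; apply/l2norm_leP => //; rewrite -{2}(normcR a0).
exact: l2sumZ.
Qed.

Lemma bounded_operatorP (T : {linear l2 R V -> l2 R V}) : bounded_operator T ->
  exists2 M, 0 <= M & forall f, (l2sum (val (T f)) <= (M ^+ 2)%:E * l2sum (val f))%E.
Proof.
move=> [M TM]; exists `|M| => // f; apply/l2norm_leP => //.
by apply: le_trans (TM f) _; rewrite ler_wpM2r ?l2norm_ge0 ?ler_norm.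
Qed.

Lemma bounded_operatorB (T S : {linear l2 R V -> l2 R V}) :
  bounded_operator T -> bounded_operator S -> bounded_operator (T \- S).
Proof.
move=> /bounded_operatorP[M M0 TM] /bounded_operatorP[L L0 SL].
exists (Num.sqrt (2 * (M ^+ 2 + L ^+ 2))) => f.
apply/l2norm_leP; rewrite ?sqrtr_ge0// sqr_sqrtr; last first.
  by rewrite mulr_ge0// addr_ge0// sqr_ge0.
have -> : val ((T \- S) f) = (val (T f) + -1 *: val (S f))%R by rewrite scaleN1r.
apply: le_trans (l2sumD _ _) _.
rewrite EFinM -muleA lee_wpmul2l ?lee_fin//.
rewrite EFinD ge0_muleDl ?lee_fin ?sqr_ge0// leeD//.
apply: le_trans (l2sumZ _ _) _.
by rewrite normcN normc1 expr1n mul1e.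
Qed.

(** Boundedness makes the supremum defining the operator norm an actual upper
    bound. *)
Lemma l2norm_operator_norm (T : {linear l2 R V -> l2 R V}) f :
  bounded_operator T -> 0 < l2norm f ->
  l2norm (T f) <= operator_norm T * l2norm f.
Proof.
move=> [M TM] f0; set c := l2norm f in f0 *.
have c'0 : 0 <= c^-1 by rewrite invr_ge0 ltW.
pose f' := (c^-1)%:C *: f.
have f'1 : l2norm f' <= 1.
  by apply: le_trans (l2normZ_le _ c'0) _; rewrite mulVf ?gt_eqF.
have Tf' : l2norm (T f') <= operator_norm T.
  apply: ub_le_sup; last by exists f'.
  exists `|M| => _ [g g1 <-]; apply: le_trans (TM g) _.
  apply: (@le_trans _ _ (`|M| * l2norm g)).
    by rewrite ler_wpM2r ?l2norm_ge0 ?ler_norm.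
  by rewrite ler_piMr.
have -> : T f = c%:C *: T f'.
  by rewrite /f' linearZ scalerA -rmorphM mulfV ?gt_eqF// rmorph1 scale1r.
apply: le_trans (l2normZ_le _ (ltW f0)) _.
by rewrite mulrC ler_wpM2r// ltW.
Qed.

Lemma operator_norm_le (T : {linear l2 R V -> l2 R V}) (c : R) : 0 <= c ->
  (forall f, (l2sum (val (T f)) <= (c ^+ 2)%:E * l2sum (val f))%E) ->
  operator_norm T <= c.
Proof.
move=> c0 Tc; apply: ge_sup.
  exists (l2norm (T 0)), 0 => //=.
  have -> : (0 : l2 R V) = 0%:C *: 0 by rewrite scaler0.
  by apply: le_trans (l2normZ_le _ (lexx 0)) _; rewrite mul0r.
move=> _ [f f1 <-]; apply: (@le_trans _ _ (c * l2norm f)).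
  exact/l2norm_leP.
by rewrite ler_piMr.
Qed.

End L2.

Lemma card_le_seq (T : eqType) (s : seq T) (d : nat) (A : set T) :
  (size s <= d)%N -> (forall x, A x -> x \in s) -> (A #<= `I_d)%card.
Proof.
case: s => [|x0 s] sd As.
  by rewrite (_ : A = set0) ?card_ge0//; apply/seteqP; split=> // x /As.
apply: card_le_trans (_ : (`I_(size (x0 :: s)) #<= `I_d)%card).
  apply: card_le_trans (card_image_le (nth x0 (x0 :: s)) _).
  apply: subset_card_le => x /As xs; exists (index x (x0 :: s)).
    by rewrite /mkset index_mem.
  exact: nth_index.
by rewrite card_le_II.
Qed.

Lemma card_le_preimage (T : Type) (X : finType) (h : X -> T) (p : pred X)
    (d : nat) (A : set T) : injective h -> (forall x, p x -> A (h x)) ->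
  (A #<= `I_d)%card -> (#|p| <= d)%N.
Proof.
move=> hI pA Ad; rewrite -card_le_II; apply: card_le_trans Ad.
have e : (h @` [set` p] #= [set` p])%card by apply: inj_card_eq => x y _ _ /hI.
apply: (card_le_trans (B := [set` p])); last first.
  rewrite -(card_le_eql e); apply: subset_card_le => _ [x px <-]; exact: pA.
apply: card_le_trans (card_image_le (index^~ (enum p)) _).
apply: subset_card_le => k kp; have [x0 _] : exists x0, x0 \in p.
  by apply/card_gt0P; apply: leq_ltn_trans kp.
exists (nth x0 (enum p) k); last by rewrite index_uniq ?enum_uniq -?cardE.
by have := mem_nth x0 (_ : k < size (enum p))%N; rewrite -cardE mem_enum; apply.
Qed.

(** * Block-diagonal operators *)

Section Blocks.
Local Open Scope complex_scope.
Variables (R : realType) (W : nat -> finType).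
Local Notation V := {n : nat & W n}.

Lemma l2sum_blocks (f : V -> R[i]) : l2sum f =
  \esum_(n in [set: nat]) (\sum_(x : W n) normc (f (Tagged W x)) ^+ 2)%:E.
Proof.
pose J n := [set Tagged W x | x in [set: W n]].
have -> : l2sum f = \esum_(v in \bigcup_(n in [set: nat]) J n) (normc (f v) ^+ 2)%:E.
  congr (esum _ _); apply/seteqP; split=> // -[n x] _.
  by exists n => //; exists x.
rewrite esum_bigcupT; last 2 first.
- by move=> m n _ _ [_ [[x _ <-] [y _ /(congr1 tag) /= ->]]].
- by move=> v; rewrite lee_fin sqr_ge0.
apply: eq_esum => n _; rewrite esum_image; last first.
  by move=> x y _ _ /eqP; rewrite eq_Tagged => /eqP.
rewrite esum_fset; last 2 first.
- exact: finite_finset.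
- by move=> x _; rewrite lee_fin sqr_ge0.
rewrite fsumEFin; last exact: finite_finset.
rewrite (_ : [set: W n] = [set` index_enum (W n)]); last first.
  by apply/seteqP; split=> // x _ /=; rewrite mem_index_enum.
by rewrite -fsbig_seq ?index_enum_uniq.
Qed.

(** Norm bounds on a block-diagonal operator reduce to bounds on its blocks that
    are uniform in the block. *)
Lemma le_l2sum_blocks (c : R) (g f : V -> R[i]) : 0 <= c ->
  (forall n, \sum_(x : W n) normc (g (Tagged W x)) ^+ 2 <=
     c * \sum_(x : W n) normc (f (Tagged W x)) ^+ 2) ->
  (l2sum g <= c%:E * l2sum f)%E.
Proof.
move=> c0 gf; rewrite !l2sum_blocks; apply: le_esumZ => // n.
by apply: sumr_ge0 => x _; rewrite sqr_ge0.
Qed.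

Variable T : forall n, W n -> W n -> R.

Definition block_fun (f : V -> R[i]) (v : V) : R[i] :=
  \sum_(y : W (tag v)) (T (tagged v) y)%:C * f (Tagged W y).

Variable c : R.
Hypothesis c0 : 0 <= c.
Hypothesis Tc : forall n g f,
  2 * (\sum_x g x * \sum_y @T n x y * f y) <= c * (sqnorm g + sqnorm f).

Lemma normc_sqrE (z : R[i]) : normc z ^+ 2 = complex.Re z ^+ 2 + complex.Im z ^+ 2.
Proof. by case: z => a b; rewrite sqr_sqrtr ?addr_ge0 ?sqr_ge0. Qed.

(** The blocks are real, so they act separately on real and imaginary parts. *)
Lemma l2sum_block_fun f : (l2sum (block_fun f) <= (c ^+ 2)%:E * l2sum f)%E.
Proof.
apply: le_l2sum_blocks => [|n]; first exact: sqr_ge0.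
pose F := fun x : W n => f (Tagged W x).
under eq_bigr do rewrite normc_sqrE.
under [X in _ <= _ * X]eq_bigr do rewrite normc_sqrE.
rewrite !big_split /= mulrDr.
have ReE x : complex.Re (block_fun f (Tagged W x)) = \sum_y T x y * complex.Re (F y).
  rewrite /block_fun /=; elim/big_rec2: _ => // y a b _ <-.
  by rewrite -/(F y); case: (F y) (b) => p q [p' q'] /=; rewrite mul0r subr0.
have ImE x : complex.Im (block_fun f (Tagged W x)) = \sum_y T x y * complex.Im (F y).
  rewrite /block_fun /=; elim/big_rec2: _ => // y a b _ <-.
  by rewrite -/(F y); case: (F y) (b) => p q [p' q'] /=; rewrite mul0r addr0.
have bound := sqnorm_form_bound c0 (Tc (n := n)).
apply: lerD.
  under eq_bigr do rewrite ReE.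
  exact: (bound (fun y => complex.Re (F y))).
under eq_bigr do rewrite ImE.
exact: (bound (fun y => complex.Im (F y))).
Qed.

Lemma block_fun_square_summable (f : l2 R V) : square_summable (block_fun (val f)).
Proof.
apply: le_lt_trans (l2sum_block_fun _) _.
by rewrite lte_mul_pinfty ?lee_fin ?sqr_ge0//; exact: (valP f).
Qed.

Definition block_operator (f : l2 R V) : l2 R V :=
  exist (fun g => is_true (square_summable g)) _ (block_fun_square_summable f).

Lemma block_fun_linear a f g :
  block_fun (a *: f + g) = a *: block_fun f + block_fun g.
Proof.
apply/funext => v; rewrite -[RHS]/(a * block_fun f v + block_fun g v).
rewrite /block_fun mulr_sumr -big_split.
apply: eq_bigr => y _; rewrite -[(a *: f + g) _]/(a * f _ + g _).
by rewrite mulrDr mulrCA.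
Qed.

Lemma block_operator_linear : linear block_operator.
Proof. by move=> a f g; apply/val_inj; exact: block_fun_linear. Qed.

HB.instance Definition _ := GRing.isLinear.Build R[i] (l2 R V) (l2 R V) *:%R
  block_operator block_operator_linear.

Lemma block_operator_bounded : bounded_operator block_operator.
Proof.
by exists c => f; apply/l2norm_leP => //; exact: l2sum_block_fun.
Qed.

End Blocks.

(** * The Laplacian of a union of complete bipartite graphs *)

Section GammaL.
Local Open Scope complex_scope.
Variables (R : realType) (k l : nat -> nat).
Local Notation W := (fun n => ('I_(k n) + 'I_(l n))%type : finType).
Local Notation V := {n : nat & ('I_(k n) + 'I_(l n))%type}.
Local Notation G := (Gamma k l).
Local Notation vertex n x := (Tagged (fun n => ('I_(k n) + 'I_(l n))%type) (x : W n)).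

Lemma big_neighbors (M : Type) (idx : M) (op : Monoid.com_law idx) (v : V)
    (F : V -> M) :
  \big[op/idx]_(w \in neighbors G v) F w =
  \big[op/idx]_(y : W (tag v) | bipartite_adj (tagged v) y) F (Tagged W y).
Proof.
have -> : neighbors G v =
    [set Tagged W y | y in [set y | bipartite_adj (tagged v) y]].
  case: v => n x; apply/seteqP; split=> [[m y]|_ [y xy <-]].
    rewrite /neighbors /= /union_adj /=; case: eqP => //= nm.
    by case: _ / nm y => y; rewrite tagged_asE => xy; exists y.
  by rewrite /neighbors /= /union_adj /= eqxx tagged_asE.
rewrite fsbig_image => [|x y _ _ /eqP]; last by rewrite eq_Tagged => /eqP.
rewrite -[RHS]big_filter.
have -> : [set y | bipartite_adj (tagged v) y] =
    [set` [seq y <- index_enum (W (tag v)) | bipartite_adj (tagged v) y]].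
  apply/seteqP; split=> y /=; first by rewrite mem_filter mem_index_enum andbT.
  by rewrite mem_filter => /andP[].
by rewrite -fsbig_seq// filter_uniq ?index_enum_uniq.
Qed.

Lemma degree_Gamma v : degree G v = #|[pred y | bipartite_adj (tagged v) y]|.
Proof.
rewrite /degree -sum1_size -fsbig_finite; last exact: adj_lf.
by rewrite big_neighbors sum1_card.
Qed.

Lemma degree_left n (i : 'I_(k n)) : degree G (vertex n (inl i)) = l n.
Proof.
by rewrite degree_Gamma -sum1_card big_sumType /= big_pred0// sum1_card card_ord.
Qed.

Lemma degree_right n (j : 'I_(l n)) : degree G (vertex n (inr j)) = k n.
Proof.
rewrite degree_Gamma -sum1_card big_sumType /= [X in (_ + X)%N]big_pred0//.
by rewrite addn0 sum1_card card_ord.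
Qed.

Definition bip (a b : nat) (B : 'I_a -> 'I_b -> R) (x y : 'I_a + 'I_b) : R :=
  match x, y with
  | inl i, inr j => B i j
  | inr j, inl i => B i j
  | _, _ => 0
  end.

Lemma bip_sym a b (B : 'I_a -> 'I_b -> R) x y : bip B x y = bip B y x.
Proof. by case: x y => [i|j] []. Qed.

Definition weight n (i : 'I_(k n)) (j : 'I_(l n)) : R :=
  (Num.sqrt ((k n)%:R * (l n)%:R))^-1.

Lemma adjacency_Gamma (f : V -> R[i]) :
  adjacency_fun G f = block_fun (fun n => bip (@weight n)) f.
Proof.
apply/funext => -[n x].
rewrite /adjacency_fun big_neighbors /block_fun big_mkcond.
apply: eq_bigr => y _ /=.
case: x y => [i|j] [i'|j'] /=; rewrite ?mul0r// degree_left degree_right//.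
by rewrite [X in Num.sqrt X]mulrC.
Qed.

(** The form of the symmetric matrix is the sum of two forms of [B], one for
    each pairing of a left half with a right half. *)
Lemma form_bip a b (B : 'I_a -> 'I_b -> R) (c : R) :
  (forall g f, 2 * (\sum_i \sum_j g i * B i j * f j) <= c * (sqnorm g + sqnorm f)) ->
  forall g f, 2 * (\sum_x g x * \sum_y bip B x y * f y) <= c * (sqnorm g + sqnorm f).
Proof.
move=> Bc g f; rewrite /sqnorm !big_sumType /=.
have left i : \sum_y bip B (inl i) y * f y = \sum_j B i j * f (inr j).
  by rewrite big_sumType /= big1 ?add0r// => i' _; rewrite mul0r.
have right j : \sum_y bip B (inr j) y * f y = \sum_i B i j * f (inl i).
  by rewrite big_sumType /= [X in _ + X]big1 ?addr0// => j' _; rewrite mul0r.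
under eq_bigr do rewrite left; under [X in _ + X]eq_bigr do rewrite right.
have := Bc (fun i => g (inl i)) (fun j => f (inr j)).
have := Bc (fun i => f (inl i)) (fun j => g (inr j)).
have -> : \sum_i g (inl i) * \sum_j B i j * f (inr j) =
    \sum_i \sum_j g (inl i) * B i j * f (inr j).
  apply: eq_bigr => i _; rewrite mulr_sumr; apply: eq_bigr => j _.
  by rewrite mulrA.
have -> : \sum_j g (inr j) * \sum_i B i j * f (inl i) =
    \sum_i \sum_j f (inl i) * B i j * g (inr j).
  rewrite exchange_big; apply: eq_bigr => j _; rewrite mulr_sumr.
  by apply: eq_bigr => i _; rewrite mulrC [B i j * _]mulrC.
rewrite /sqnorm; lra.
Qed.

Lemma delta_block (T : forall n, W n -> W n -> R) (v w : V) :
  block_fun T (val (delta R w)) v != 0 ->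
  exists2 y : W (tag v), w = Tagged W y & T (tag v) (tagged v) y != 0.
Proof.
move=> nz; apply: contrapT => /forall2NP h; move/eqP: nz; apply.
rewrite /block_fun big1// => y _; have [yw|/negP/negPn/eqP ->] := h y.
  by rewrite /delta /= (_ : _ == w = false) ?mulr0//; apply/eqP => /esym.
by rewrite mul0r.
Qed.

Section Approximation.
Variables (B : forall n, 'I_(k n) -> 'I_(l n) -> R) (c : R) (m : nat).
Hypothesis c0 : 0 <= c.
Hypothesis Brow : forall n i, (#|[pred j | @B n i j != 0%R]| <= m)%N.
Hypothesis Bcol : forall n j, (#|[pred i | @B n i j != 0%R]| <= m)%N.
Hypothesis Bc : forall n g f, 2 * (\sum_i \sum_j g i * @B n i j * f j -
  (Num.sqrt ((k n)%:R * (l n)%:R))^-1 * ((\sum_i g i) * \sum_j f j)) <=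
    c * (sqnorm g + sqnorm f).

Definition defect n : W n -> W n -> R :=
  bip (fun i j => @B n i j - @weight n i j).

Lemma defect_bound n g f :
  2 * (\sum_x g x * \sum_y @defect n x y * f y) <= c * (sqnorm g + sqnorm f).
Proof.
apply: form_bip => {}g {}f; apply: le_trans (Bc g f).
rewrite ler_pM2l ?ltr0n// le_eqVlt; apply/orP; left; apply/eqP.
under eq_bigr => i _ do under eq_bigr => j _ do rewrite mulrBr mulrBl.
under eq_bigr do rewrite sumrB.
rewrite sumrB; congr (_ - _).
rewrite mulr_suml mulr_sumr; apply: eq_bigr => i _.
rewrite !mulr_sumr; apply: eq_bigr => j _.
by rewrite [RHS]mulrCA mulrA.
Qed.

(** Defined as the Laplacian minus a block operator of norm at most [c], so that
    linearity, boundedness and closeness are immediate; its blocks are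
    the identity minus those of [bip (@B n)] ([val_approximant]). *)
Definition approximant : {linear l2 R V -> l2 R V} :=
  laplacian G \- block_operator c0 defect_bound.

Lemma val_approximant f :
  val (approximant f) = (val f - block_fun (fun n => bip (@B n)) (val f))%R.
Proof.
apply/funext => v.
rewrite -[LHS]/(laplacian_fun G (val f) v - block_fun defect (val f) v).
rewrite -[RHS]/(val f v - block_fun (fun n => bip (@B n)) (val f) v).
rewrite /laplacian_fun adjacency_Gamma -addrA -opprD; congr (_ - _).
rewrite /block_fun -big_split; apply: eq_bigr => y _ /=.
rewrite -mulrDl -rmorphD /=; congr (_%:C * _).
by case: (tagged v) y => [i|j] [i'|j'] /=; rewrite ?addr0// addrC subrK.
Qed.

Lemma approximant_entry v w : matrix_entry approximant v w != 0 ->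
  v = w \/ exists2 y : W (tag v), w = Tagged W y & bip (@B (tag v)) (tagged v) y != 0.
Proof.
rewrite /matrix_entry val_approximant => nz.
have [->|vw] := eqVneq v w; [by left|right].
apply: (@delta_block (fun n => bip (@B n))); apply: contraNneq nz => bz.
rewrite -[X in X == _]/(val (delta R w) v - block_fun (fun n => bip (@B n)) _ v).
by rewrite bz subr0 /delta /= (negPf vw).
Qed.

Lemma bip_sparse n (x : W n) : (#|[pred y | bip (@B n) x y != 0%R]| <= m)%N.
Proof.
case: x => [i|j].
  apply: leq_trans (Brow i); rewrite -!sum1_card big_sumType /=.
  by rewrite big_pred0 ?add0n// => i'; rewrite !inE /= eqxx.
apply: leq_trans (Bcol j); rewrite -!sum1_card big_sumType /=.
by rewrite [X in (_ + X)%N]big_pred0 ?addn0// => j'; rewrite !inE /= eqxx.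
Qed.

Lemma approximant_banded : banded m.+1 approximant.
Proof.
have near (v : V) (A : set V) : (forall w, A w -> v = w \/
    exists2 y : W (tag v), w = Tagged W y & bip (@B (tag v)) (tagged v) y != 0) ->
    (A #<= `I_m.+1)%card.
  move=> Av; pose s := [seq Tagged W y | y <- enum [pred y | bip (@B (tag v)) (tagged v) y != 0%R]].
  apply: (@card_le_seq _ (v :: s)).
    by rewrite /= size_map -cardE ltnS bip_sparse.
  move=> w /Av[->|[y -> yB]]; first exact: mem_head.
  by rewrite inE; apply/orP; right; apply: map_f; rewrite mem_enum.
split=> [|v|w].
- apply: bounded_operatorB; first exact: laplacian_bounded.
  exact: block_operator_bounded.
- by apply: (near v) => w; exact: approximant_entry.
apply: (near w) => -[n x] /approximant_entry[->|[y -> xy]]; first by left.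
by right; exists x; rewrite // bip_sym.
Qed.

Lemma approximant_close : operator_norm (laplacian G \- approximant) <= c.
Proof.
apply: operator_norm_le => // f.
rewrite (_ : val _ = block_fun defect (val f)); last first.
  apply/funext => v.
  rewrite -[LHS]/(laplacian_fun G (val f) v -
    (laplacian_fun G (val f) v - block_fun defect (val f) v)).
  by rewrite opprB addrC subrK.
exact: (l2sum_block_fun c0 defect_bound).
Qed.

End Approximation.
End GammaL.

(** * The criterion *)

Lemma bounded_ratio_AULF (R : realType) (k l : nat -> nat) (C : nat) :
  (forall n, (0 < k n)%N) -> (forall n, (k n <= l n)%N) ->
  (forall n, (l n <= C * k n)%N) -> AULF R (Gamma k l).
Proof.
move=> k0 kl lC; split=> [|e e0]; first exact: laplacian_bounded.
have e20 : 0 < e / 2 by rewrite divr_gt0.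
have [m Hm] := sparse_bipartite C e20.
pose BH n := cid (Hm _ _ (k0 n) (kl n) (lC n)).
pose B n := sval (BH n).
have Brow n i : (#|[pred j | B n i j != 0%R]| <= m)%N.
  by have [h _ _] := svalP (BH n); exact: h.
have Bcol n j : (#|[pred i | B n i j != 0%R]| <= m)%N.
  by have [_ h _] := svalP (BH n); exact: h.
have Bc n g f : 2 * (\sum_i \sum_j g i * B n i j * f j -
    (Num.sqrt ((k n)%:R * (l n)%:R))^-1 * ((\sum_i g i) * \sum_j f j)) <=
    e / 2 * (sqnorm g + sqnorm f).
  by have [_ _ h] := svalP (BH n); exact: h.
exists (approximant (ltW e20) Bc).
  by exists m.+1 => //; exact: approximant_banded.
apply: le_lt_trans (approximant_close _ _) _.
by rewrite ltr_pdivrMr// ltr_pMr// ltr1n.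
Qed.

Section Converse.
Variables (R : realType) (k l : nat -> nat).
Hypothesis k0 : forall n, (0 < k n)%N.
Hypothesis l0 : forall n, (0 < l n)%N.
Local Notation W := (fun n => ('I_(k n) + 'I_(l n))%type : finType).
Local Notation V := {n : nat & ('I_(k n) + 'I_(l n))%type}.
Local Notation G := (Gamma k l).
Local Notation vertex n x := (Tagged (fun n => ('I_(k n) + 'I_(l n))%type) (x : W n)).

Definition indicator n (X : {set 'I_(l n)}) : l2 R V :=
  \sum_(j in X) delta R (vertex n (inr j)).

Lemma indicatorE n (X : {set 'I_(l n)}) v :
  val (indicator X) v = \sum_(j in X) (v == vertex n (inr j))%:R.
Proof.
rewrite /indicator; elim/big_rec2: _ => [//|j a b _ <-].
by [].
Qed.

Lemma indicator_left n (X : {set 'I_(l n)}) i :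
  val (indicator X) (vertex n (inl i)) = 0.
Proof. by rewrite indicatorE big1// => j _; rewrite eq_Tagged. Qed.

Lemma indicator_right n (X : {set 'I_(l n)}) j :
  val (indicator X) (vertex n (inr j)) = (j \in X)%:R.
Proof.
rewrite indicatorE big_mkcond (bigD1 j)//= eqxx big1 ?addr0 => [|j' jj'].
  by case: ifP.
by rewrite eq_Tagged /= -[_ == _]/(j == j') eq_sym (negPf jj') if_same.
Qed.

Lemma l2sum_indicator n (X : {set 'I_(l n)}) :
  l2sum (val (indicator X)) = (#|X|%:R)%:E.
Proof.
rewrite l2sum_blocks.
transitivity (\esum_(p in [set: nat]) (if p \in [set n] then (#|X|%:R)%:E else 0%E : \bar R)).
  apply: eq_esum => p _; case: ifPn => [|pn].
    rewrite inE => ->; congr (_%:E).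
    rewrite big_sumType /= big1 ?add0r => [|i _]; last first.
      by rewrite indicator_left normc0 expr0n.
    rewrite -sum1_card natr_sum [RHS]big_mkcond; apply: eq_bigr => j _ /=.
    by rewrite indicator_right; case: ifP; rewrite ?normc1 ?normc0 ?expr1n ?expr0n.
  congr (_%:E); apply: big1 => x _; rewrite indicatorE big1 ?normc0 ?expr0n// => j _.
  rewrite (_ : _ == _ = false)//; apply/negbTE; apply: contra pn => /eqP /(congr1 tag) /= ->.
  by rewrite inE.
by rewrite -esum_mkcond esum_set1// lee_fin ler0n.
Qed.

Lemma laplacian_indicator n (X : {set 'I_(l n)}) i :
  val (laplacian G (indicator X)) (vertex n (inl i)) =
  - ((#|X|%:R / Num.sqrt ((k n)%:R * (l n)%:R))%:C)%C.
Proof.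
rewrite -[LHS]/(val (indicator X) (vertex n (inl i)) -
  adjacency_fun G (val (indicator X)) (vertex n (inl i))).
rewrite indicator_left sub0r adjacency_Gamma; congr (- _).
rewrite /block_fun big_sumType /= big1 ?add0r => [|i' _]; last by rewrite mul0r.
transitivity (\sum_(j : 'I_(l n))
    ((Num.sqrt ((k n)%:R * (l n)%:R))^-1)%:C%C * ((j \in X)%:R : R[i])).
  by apply: eq_bigr => j _; rewrite indicator_right.
rewrite -mulr_sumr mulrC rmorphM /= -sum1_card natr_sum rmorph_sum big_mkcond /=.
by congr (_ * _); rewrite [RHS]big_mkcond; apply: eq_bigr => j _; case: ifP.
Qed.

Definition zero_columns (S : {linear l2 R V -> l2 R V}) n : {set 'I_(l n)} :=
  finset (fun j =>
    [forall i, matrix_entry S (vertex n (inl i)) (vertex n (inr j)) == 0%R]).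

(** The columns counted out contain one of the at most [k n * d] non-zero
    entries of the left rows. *)
Lemma card_zero_columns (S : {linear l2 R V -> l2 R V}) d n :
  banded d S -> (l n <= #|zero_columns S n| + k n * d)%N.
Proof.
move=> [_ Srow _].
rewrite -[leqLHS]card_ord -(cardsC (zero_columns S n)) leq_add2l.
pose e i j := matrix_entry S (vertex n (inl i)) (vertex n (inr j)) != 0%R.
apply: (@leq_trans (\sum_j \sum_i e i j)%N).
  rewrite -sum1_card big_mkcond; apply: leq_sum => j _.
  case: ifP => //; rewrite finset.in_setC inE negb_forall => /existsP[i eij].
  by rewrite (bigD1 i)//= /e eij.
rewrite exchange_big -[in leqRHS](card_ord (k n)) -sum_nat_const.
apply: leq_sum => i _; rewrite -big_mkcond sum1_card.
apply: (card_le_preimage (h := fun j => vertex n (inr j)) _ _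
  (Srow (vertex n (inl i)))) => // j j' /eqP.
by rewrite eq_Tagged => /eqP[].
Qed.

Lemma zero_columns_indicator (S : {linear l2 R V -> l2 R V}) n i :
  val (S (indicator (zero_columns S n))) (vertex n (inl i)) = 0.
Proof.
rewrite /indicator linear_sum.
apply: (big_ind (fun g : l2 R V => val g (vertex n (inl i)) = 0)) => //.
  move=> g h g0 h0.
  by rewrite -[LHS]/(val g (vertex n (inl i)) + val h (vertex n (inl i))) g0 h0 addr0.
by move=> j; rewrite inE => /forallP/(_ i)/eqP.
Qed.

(** The indicator of the zero columns separates the Laplacian from a banded
    operator: on the left vertices only the Laplacian sees it. *)
Lemma AULF_bounded_ratio : AULF R G -> exists C, forall n, (l n <= C * k n)%N.
Proof.
move=> [_ /(_ (2^-1))[|S [d _ Sd] LS]]; first by rewrite invr_gt0.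
exists (2 * d)%N => n.
have lX := card_zero_columns n Sd.
suff X4 : (4 * #|zero_columns S n| <= l n)%N.
  by rewrite -mulnA [(d * _)%N]mulnC; move: lX X4; set x := #|_|; lia.
have [X0|X0] := posnP #|zero_columns S n|; first by rewrite X0 muln0.
pose u := indicator (zero_columns S n).
have u_sq : l2norm u ^+ 2 = #|zero_columns S n|%:R.
  by apply: EFin_inj; rewrite sqr_l2norm l2sum_indicator.
have u0 : 0 < l2norm u.
  rewrite lt0r l2norm_ge0 andbT; apply: contraPneq u_sq => ->.
  by rewrite expr0n => /esym/eqP; rewrite pnatr_eq0 gtn_eqF.
have Sb : bounded_operator S by case: Sd.
have := l2norm_operator_norm (bounded_operatorB (laplacian_bounded R G) Sb) u0.
move=> /le_trans/(_ (ler_wpM2r (l2norm_ge0 u) (ltW LS))).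
move=> /l2norm_leP -/(_ ltac:(by rewrite invr_ge0)).
rewrite -(sqr_l2norm u) u_sq.
set D := (laplacian G \- S) u.
have Dleft i : val D (vertex n (inl i)) =
    - ((#|zero_columns S n|%:R / Num.sqrt ((k n)%:R * (l n)%:R))%:C)%C.
  rewrite -[LHS]/(val (laplacian G u) (vertex n (inl i)) - val (S u) (vertex n (inl i))).
  by rewrite zero_columns_indicator subr0 laplacian_indicator.
have : ((#|zero_columns S n|%:R ^+ 2 / (l n)%:R)%:E <= l2sum (val D))%E.
  rewrite l2sum_blocks; apply: esum_ge; exists [set n]; first by split.
  rewrite fsbig_set1 lee_fin big_sumType /=.
  rewrite [X in _ <= X + _](_ : _ = #|zero_columns S n|%:R ^+ 2 / (l n)%:R).
    by rewrite lerDl sumr_ge0// => j _; rewrite sqr_ge0.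
  transitivity (\sum_(i : 'I_(k n))
      (#|zero_columns S n|%:R / Num.sqrt ((k n)%:R * (l n)%:R)) ^+ 2 : R).
    apply: eq_bigr => i _; have /(congr1 (@normc R)) := Dleft i.
    by rewrite normcN normcR ?divr_ge0 ?sqrtr_ge0// => <-.
  rewrite sumr_const card_ord exprMn exprVn sqr_sqrtr ?mulr_ge0//.
  rewrite -mulr_natl; field.
  by rewrite !pnatr_eq0 -!lt0n k0 l0.
move=> /le_trans h /h.
rewrite -EFinM lee_fin ler_pdivrMr ?ltr0n// expr2.
rewrite mulrAC ler_pM2r ?ltr0n// exprVn ler_pdivlMl ?exprn_gt0//.
by rewrite -natrX -natrM ler_nat.
Qed.
End Converse.

Theorem proposition6 (R : realType) (k l : nat -> nat)
    (k_gt0 : forall n, (0 < k n)%N) (l_gt0 : forall n, (0 < l n)%N)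
    (k_le_l : forall n, (k n <= l n)%N) :
  (bounded_fun ((fun n => (l n)%:R / (k n)%:R : R) : nat -> R^o) ->
     AULF R (Gamma k l)) /\
  (~ bounded_fun ((fun n => (l n)%:R / (k n)%:R : R) : nat -> R^o) ->
     ~ AULF R (Gamma k l)).
Proof.
split.
  move=> /pinfty_ex_gt0[M M0 /= ratioM].
  apply: (@bounded_ratio_AULF _ _ _ (Num.truncn M).+1) => // n.
  have := ratioM n I; rewrite ger0_norm ?divr_ge0//.
  rewrite ler_pdivrMr ?ltr0n// => h.
  rewrite -(ler_nat R) natrM; apply: le_trans h _.
  by rewrite ler_wpM2r// ltW// truncnS_gt.
apply: contra_not => /(AULF_bounded_ratio k_gt0 l_gt0)[C lC].
exists C%:R; split; first exact: num_real.
move=> M CM n _ /=; apply: le_trans (ltW CM).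
by rewrite ger0_norm ?divr_ge0// ler_pdivrMr ?ltr0n// -natrM ler_nat.
Qed.
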